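(* Let $E=\mathbb R$. Suppose that $\inf_{y\in\mathbb R}\kappa(y)\ge\underline\kappa$ for some $\underline\kappa>0$ and that there are $C_*>0$, $\alpha_*>0$ with $|a(y)|+|\widetilde b(y)|+\kappa(y)\le C_*(1+|y|^{\alpha_*})$ for all $y\in\mathbb R$. For $R>1$ let $h_R$ be the unique classical solution of $$\frac{a(y)^2}{2}h''+\widetilde b(y)h'-\kappa(y)h+\eta h^p=0\ \text{ in }(-R,R),\qquad h(\pm R)=\frac1{\kappa(\pm R)}.$$ Then there exist a sequence $R_n\to\infty$ and a positive function $h_*\in C^{2,\alpha}(\mathbb R)$ such that $h_{R_n}\to h_*$ locally in $C^2(\mathbb R)$ and $h_*$ solves $$\frac{a(y)^2}{2}h''(y)+\widetilde b(y)h'(y)-\kappa(y)h(y)+\eta h(y)^p=0,\qquad y\in\mathbb R.$$ Moreover, for all $y\in\mathbb R$, $$c_0(1+y^2)^{-\alpha^\dagger/2}\le h_*(y)\le\max\Big\{\frac1{\underline\kappa},\Big(\frac{\eta}{\underline\kappa}\Big)^{\frac1{1-p}}\Big\},$$ where $\alpha^\dagger$ and $c_0>0$ are the constants described in the context.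
   Context: Let $n\in\mathbb N$, $E=\mathbb R$, $\alpha\in(0,1)$. Let $r,b\in C^{1,\alpha}(E;\mathbb R)$, $\mu\in C^{1,\alpha}(E;\mathbb R^n)$; $a:E\to\mathbb R$ and $\sigma:E\to\mathbb R^{n\times n}$ Borel; $\rho\in\mathbb R^n$ constant with $|\rho|\le1$; $a^2$, $\Sigma:=\sigma\sigma^\top$ and $\Upsilon:=a\sigma\rho$ of class $C^{2,\alpha}$ on $E$ (Hölder classes on open sets are local). For every $y\in E$, $\Sigma(y)$ is positive definite and $a(y)^2>0$. Standing assumption: for every initial point in $\mathbb R^n\times E$ the martingale problem on $C([0,\infty);\mathbb R^n\times E)$ for $\frac12\sum\widehat A_{ij}\partial_{ij}+\sum\widehat b_i\partial_i$, $\widehat A=\begin{pmatrix}\Sigma&\Upsilon\\ \Upsilon^\top&a^2\end{pmatrix}$, $\widehat b=(\mu^\top,b)^\top$ (coefficients evaluated at the last coordinate), has a unique solution. Parameters: $\delta\in\mathbb R$, $\beta>0$, $\psi,\gamma\in(0,\infty)\setminus\{1\}$, $\vartheta:=\frac{1-\gamma}{1-1/\psi}>0$. Put $\chi:=\frac{\gamma}{\gamma+(1-\gamma)\rho^\top\rho}>0$, $p:=1-\frac{\chi(\psi-1)}{1-\gamma}<1$, $\eta:=\frac{\beta^\psi(1-\gamma)}{\chi(\psi-1)}>0$, $\widetilde b:=b-(1-\frac1\gamma)\mu^\top\Sigma^{-1}\Upsilon$, $\kappa:=\frac{1-\gamma}{\chi(\psi-1)}\big[\delta\psi+(1-\psi)\big(r+\frac1{2\gamma}\mu^\top\Sigma^{-1}\mu\big)\big]$.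 A classical solution of the boundary value problem on $[-R,R]$ is a function in $C^2((-R,R))\cap C([-R,R])$ for which $h^p$ makes sense ($h\ge0$, and $h>0$ in the interior if $p<0$); under the hypotheses it exists, is unique and positive. Constants: $\alpha^\dagger$ is any number with $\alpha^\dagger>\max\{\alpha_*,2\alpha_*/(1-p)\}$. Let $\phi(y)=(1+y^2)^{-\alpha^\dagger/2}$, let $C_1>0$ (depending on $C_*,\alpha_*,\alpha^\dagger$) satisfy $|\frac{a^2}{2}\phi''+\widetilde b\phi'-\kappa\phi|\le C_1\phi(y)(1+|y|)^{2\alpha_*}$ on $\mathbb R$, let $c_1>0$ (depending on $\alpha^\dagger,\alpha_*$) satisfy $\phi(y)^{p-1}\ge c_1(1+|y|)^{2\alpha_*}$ on $\mathbb R$; then $c_0:=\min\big\{1,(\eta c_1/C_1)^{1/(1-p)},[C_*\sup_{s\ge0}(1+s^2)^{-\alpha^\dagger/2}(1+s^{\alpha_*})]^{-1}\big\}$. *)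

(* Defs.v *)
From HB Require Import structures.
From mathcomp Require Import all_boot all_order all_algebra.
From mathcomp Require Import all_classical all_reals all_analysis.
Set Implicit Arguments.
Unset Strict Implicit.
Unset Printing Implicit Defensive.
Import Order.TTheory GRing.Theory Num.Theory numFieldNormedType.Exports.
Local Open Scope ring_scope.
Local Open Scope classical_set_scope.

Section holder_classes.
Context {R : realType}.
Implicit Types f : R -> R.

Definition loc_holder (alpha : R) f :=
  forall K : set R, compact K ->
  exists C : R, forall x y, K x -> K y -> `|f x - f y| <= C * `|x - y| `^ alpha.

(* [f] is in $C^{k,\alpha}(\mathbb R)$, in the local sense *)
Definition Ckholder (k : nat) (alpha : R) f :=
  (forall j, (j < k)%N -> forall x, derivable (f^`(j)) x 1) /\
  loc_holder alpha (f^`(k)).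

Definition C2_on (A : set R) f :=
  forall x, A x ->
    [/\ derivable f x 1, derivable (f^`()) x 1 & {for x, continuous (f^`(2))}].

Definition cvg_loc_C2 (f_ : nat -> R -> R) (f : R -> R) :=
  forall j, (j <= 2)%N -> forall K : set R, compact K ->
    {uniform K, (fun n => (f_ n)^`(j)) @ \oo --> f^`(j)}.

End holder_classes.

Section martingale_problem.
Context {R : realType} {d : nat}.
Local Notation V := 'cV[R]_d.

(* $C([0,\infty);\mathbb R^d)$: a path on $[0,\infty)$ is identified with its
   unique extension to the real line that is constant on $(-\infty,0]$. *)
Record cpath := Path {
  path_fun : R -> V ;
  path_continuous : continuous path_fun ;
  path_constant : forall t, t <= 0 -> path_fun t = path_fun 0 }.
HB.instance Definition _ := gen_eqMixin cpath.
HB.instance Definition _ := gen_choiceMixin cpath.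
HB.instance Definition _ := isPointed.Build cpath
  (@Path (fun=> 0) (fun t => @cst_continuous R V 0 t) (fun _ _ => erefl)).

Definition eval_at (t : R) (w : cpath) : V := path_fun w t.

Definition cylinders (T : set R) : set (set cpath) :=
  [set C | exists t i (B : set R),
     [/\ T t, measurable B & C = [set w | B (eval_at t w i 0)]]].

(* Path space with the $\sigma$-algebra generated by the coordinates, which is
   the Borel $\sigma$-algebra of locally uniform convergence. *)
Definition path_space := g_sigma_algebraType (cylinders [set t | 0 <= t]).

Definition path_filtration (t : R) : set (set cpath) :=
  <<s cylinders [set s | 0 <= s <= t] >>.

Definition is_martingale (P : probability path_space R)
    (M : R -> path_space -> R) :=
  [/\ (forall t, 0 <= t ->
         forall B : set R, measurable B -> path_filtration t (M t @^-1` B)),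
      (forall t, 0 <= t -> P.-integrable setT (EFin \o M t)) &
      (forall s t, 0 <= s -> s <= t -> forall A, path_filtration s A ->
         (\int[P]_(w in A) (M t w)%:E = \int[P]_(w in A) (M s w)%:E)%E)].

Definition partial (i : 'I_d) (f : V -> R) : V -> R :=
  fun x => 'D_(delta_mx i 0) f x.

Fixpoint is_Ck (k : nat) (f : V -> R) : Prop :=
  continuous f /\
  match k with
  | 0 => True
  | k'.+1 => forall i, (forall x, derivable f x (delta_mx i 0)) /\
                       is_Ck k' (partial i f)
  end.

Definition test_function (f : V -> R) :=
  (forall k, is_Ck k f) /\ compact (closure [set x | f x != 0]).

Definition generator (A : V -> 'M[R]_d) (B : V -> V) (f : V -> R) (x : V) : R :=
  2^-1 * (\sum_i \sum_j A x i j * partial i (partial j f) x) +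
  \sum_i B x i 0 * partial i f x.

Definition solves_martingale_problem (A : V -> 'M[R]_d) (B : V -> V) (x : V)
    (P : probability path_space R) :=
  P [set w | eval_at 0 w = x] = 1%:E /\
  forall f, test_function f ->
    is_martingale P (fun t w => f (eval_at t w) - f (eval_at 0 w) -
      \int[@lebesgue_measure R]_(s in `[0, t]) generator A B f (eval_at s w)).

Definition well_posed (A : V -> 'M[R]_d) (B : V -> V) :=
  forall x, exists2 P, solves_martingale_problem A B x P &
    forall Q, solves_martingale_problem A B x Q ->
      forall S : set path_space, measurable S -> Q S = P S.

End martingale_problem.

Record market (R : realType) (n : nat) := Market {
  mkt_r : R -> R ;
  mkt_mu : R -> 'cV[R]_n ;
  mkt_sigma : R -> 'M[R]_n ;
  mkt_b : R -> R ;
  mkt_a : R -> R ;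
  mkt_rho : 'cV[R]_n }.

Record preferences (R : realType) := Preferences {
  prf_delta : R ;
  prf_beta : R ;
  prf_psi : R ;
  prf_gamma : R }.

Section market_coefficients.
Context {R : realType} {n : nat}.
Variable m : market R n.
Local Notation r := (mkt_r m).
Local Notation mu := (mkt_mu m).
Local Notation sigma := (mkt_sigma m).
Local Notation b := (mkt_b m).
Local Notation a := (mkt_a m).
Local Notation rho := (mkt_rho m).

Definition Sigma (y : R) : 'M[R]_n := sigma y *m (sigma y)^T.
Definition Upsilon (y : R) : 'cV[R]_n := a y *: (sigma y *m rho).

Definition last_coord (x : 'cV[R]_(n + 1)) : R := x (rshift n ord0) 0.

Definition A_hat (x : 'cV[R]_(n + 1)) : 'M[R]_(n + 1) :=
  let y := last_coord x in
  block_mx (Sigma y) (Upsilon y) (Upsilon y)^T (a y ^+ 2)%:M.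

Definition b_hat (x : 'cV[R]_(n + 1)) : 'cV[R]_(n + 1) :=
  let y := last_coord x in col_mx (mu y) (b y)%:M.

Definition market_assumptions (alpha : R) : Prop :=
  [/\ Ckholder 1 alpha r, Ckholder 1 alpha b &
      forall i, Ckholder 1 alpha (fun y => mu y i 0)] /\
  [/\ measurable_fun setT a &
      forall i j, measurable_fun setT (fun y => sigma y i j)] /\
  (* the norm of the library on matrices is the sup norm *)
  Num.sqrt ((rho^T *m rho) 0 0) <= 1 /\
  [/\ Ckholder 2 alpha (fun y => a y ^+ 2),
      (forall i j, Ckholder 2 alpha (fun y => Sigma y i j)) &
      forall i, Ckholder 2 alpha (fun y => Upsilon y i 0)] /\
  (forall y (v : 'cV[R]_n), v != 0 -> 0 < (v^T *m Sigma y *m v) 0 0) /\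
  (forall y, 0 < a y ^+ 2) /\
  well_posed A_hat b_hat.

Variable q : preferences R.
Local Notation delta := (prf_delta q).
Local Notation beta := (prf_beta q).
Local Notation psi := (prf_psi q).
Local Notation gamma := (prf_gamma q).

Definition vartheta : R := (1 - gamma) / (1 - psi^-1).

Definition preference_assumptions : Prop :=
  [/\ 0 < beta, 0 < psi /\ psi != 1, 0 < gamma /\ gamma != 1 & 0 < vartheta].

Definition chi : R := gamma / (gamma + (1 - gamma) * (rho^T *m rho) 0 0).
Definition pexp : R := 1 - chi * (psi - 1) / (1 - gamma).
Definition eta_cst : R := beta `^ psi * (1 - gamma) / (chi * (psi - 1)).

Definition b_tilde (y : R) : R :=
  b y - (1 - gamma^-1) * ((mu y)^T *m invmx (Sigma y) *m Upsilon y) 0 0.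

Definition kappa_fun (y : R) : R :=
  (1 - gamma) / (chi * (psi - 1)) *
  (delta * psi + (1 - psi) *
     (r y + (2 * gamma)^-1 * ((mu y)^T *m invmx (Sigma y) *m mu y) 0 0)).

Definition linear_part (h : R -> R) (y : R) : R :=
  a y ^+ 2 / 2 * h^`(2)%classic y + b_tilde y * h^`()%classic y - kappa_fun y * h y.

Definition solves_ode_at (h : R -> R) (y : R) : Prop :=
  linear_part h y + eta_cst * h y `^ pexp = 0.

(* Only the values of [h] on [[-L, L]] matter. *)
Definition classical_solution (L : R) (h : R -> R) : Prop :=
  [/\ C2_on `]-L, L[ h,
      {within `[-L, L], continuous h},
      (forall y, y \in `[-L, L] -> 0 <= h y) /\
      (pexp < 0 -> forall y, y \in `]-L, L[ -> 0 < h y),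
      forall y, y \in `]-L, L[ -> solves_ode_at h y &
      h (- L) = (kappa_fun (- L))^-1 /\ h L = (kappa_fun L)^-1].

Definition phi_fun (alpha_d : R) (y : R) : R := (1 + y ^+ 2) `^ (- alpha_d / 2).

Definition admissible_C1 (alpha_s alpha_d C1 : R) : Prop :=
  0 < C1 /\ forall y, `|linear_part (phi_fun alpha_d) y| <=
    C1 * phi_fun alpha_d y * (1 + `|y|) `^ (2 * alpha_s).

Definition admissible_c1 (alpha_s alpha_d c1 : R) : Prop :=
  0 < c1 /\ forall y, c1 * (1 + `|y|) `^ (2 * alpha_s) <=
    phi_fun alpha_d y `^ (pexp - 1).

Definition c0_cst (C_s alpha_s alpha_d C1 c1 : R) : R :=
  Num.min 1 (Num.min ((eta_cst * c1 / C1) `^ (1 - pexp)^-1)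
    (C_s * sup [set (1 + s ^+ 2) `^ (- alpha_d / 2) * (1 + s `^ alpha_s)
               | s in [set s : R | 0 <= s]])^-1).

End market_coefficients.

(* Main.v *)
Require Import Defs.
From HB Require Import structures.
From mathcomp Require Import all_boot all_order all_algebra.
From mathcomp Require Import all_classical all_reals all_analysis.
From mathcomp Require Import ring lra.
Set Implicit Arguments.
Unset Strict Implicit.
Unset Printing Implicit Defensive.
Import Order.TTheory GRing.Theory Num.Theory numFieldNormedType.Exports.
Local Open Scope ring_scope.
Local Open Scope classical_set_scope.

(* The problem on [[-L, L]] is compared with explicit functions at extremal points
   of quotients [w / h]: since [p < 1], such a contact bounds [h] from below by
   every positive subsolution that is below [h] at the endpoints. A subsolution
   vanishing at the endpoints of a fixed interval gives an interior lower bound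
   independent of [L]; a constant is an upper bound. With these bounds the
   equation reads [h'' = rhs y h h'] with [rhs] Lipschitz on the relevant range,
   so that Gronwall controls [h] on compact sets by the data [(h 0, h' 0)]. No
   Arzela-Ascoli argument is needed: a sequence along which these two numbers
   converge, given by Bolzano-Weierstrass, converges locally in C^2. *)

(** For 0 < p < 1 the term eta h^p increases with h, so the difference of a subsolution and a
    solution need not obey a maximum principle. Quotients avoid this: replacing h by c h scales the
    linear part by c and the power term by c^p, and c^p < c for c > 1 because p < 1. Dividing by h
    presupposes strict positivity, whereas for p >= 0 a classical solution is only known to be
    nonnegative; Hopf's argument closes this gap. The power is in general not Lipschitz at 0, so
    Gronwall is available only above a positive lower bound uniform in L. The barrier [c0 * phi]
    cannot provide it: its constants are quantified after the sequence and the limit have been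
    chosen. Hence a separate local barrier, built from the coefficients alone. A bound on h'(0)
    uniform in L is needed as well; it comes from the boundedness of h and the linear growth of
    [rhs] in h'. *)

(** * Calculus on the line: extrema, Gronwall's inequality, real powers *)

Section real_analysis.
Context {R : realType}.
Implicit Types (f g df : R -> R) (a b c r x y d C K : R).

Lemma continuous_epsP f x : {for x, continuous f} <-> forall e, 0 < e ->
  exists2 d, 0 < d & forall y, `|y - x| < d -> `|f y - f x| < e.
Proof.
split=> [fx e e0|fx].
  have /cvgrPdist_lt/(_ e e0) := fx.
  move=> /nbhs_ballP[d /= d0 dfx]; exists d => // y yx.
  by rewrite distrC; apply: dfx; rewrite /ball /= distrC.
apply/cvgrPdist_lt => e e0; have [d d0 dfx] := fx e e0.
apply/nbhs_ballP; exists d => // y; rewrite /ball /= distrC => /dfx.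
by rewrite distrC.
Qed.

(** First-order expansion with the quotient multiplied out and a weak inequality: it includes
    [y = x] and is stable under limits of functions. *)
Lemma is_derive_epsP f x d : is_derive x 1 f d <->
  forall e, 0 < e -> exists2 r, 0 < r & forall y, `|y - x| < r ->
    `|f y - f x - d * (y - x)| <= e * `|y - x|.
Proof.
split=> [/is_derive1_caratheodory[g [fg cg <-]] e e0|fd].
  have [r r0 rg] := (continuous_epsP g x).1 cg e e0.
  by exists r => // y yx; rewrite fg -mulrBl normrM ler_wpM2r// ltW// rg.
apply/is_derive1_caratheodory.
exists (fun z => if z == x then d else (f z - f x) / (z - x)); split.
- move=> z; case: eqP => [->|/eqP zx]; first by rewrite !subrr mulr0.
  by rewrite divfK// subr_eq0.
- apply/continuous_epsP => e e0; have [|r r0 rf] := fd (e / 2); first lra.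
  exists r => // y yx; rewrite eqxx; case: eqP => [_|/eqP yx0].
    by rewrite subrr normr0.
  have yx1 : 0 < `|y - x| by rewrite normr_gt0 subr_eq0.
  have := rf y yx; have -> : f y - f x - d * (y - x) =
      ((f y - f x) / (y - x) - d) * (y - x).
    by rewrite mulrBl divfK// subr_eq0.
  by rewrite normrM ler_pM2r// => ?; lra.
- by rewrite eqxx.
Qed.

Lemma is_derive_addfun f g x a b : is_derive x 1 f a -> is_derive x 1 g b ->
  is_derive x 1 (fun t => f t + g t) (a + b).
Proof. by move=> fa gb; exact: is_deriveD. Qed.

Lemma is_derive_subfun f g x a b : is_derive x 1 f a -> is_derive x 1 g b ->
  is_derive x 1 (fun t => f t - g t) (a - b).
Proof. by move=> fa gb; exact: is_deriveB. Qed.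

Lemma is_derive_mulfun f g x a b : is_derive x 1 f a -> is_derive x 1 g b ->
  is_derive x 1 (fun t => f t * g t) (a * g x + f x * b).
Proof.
move=> fa gb; rewrite addrC mulrC [a * _]mulrC mulrC.
exact: (@is_deriveM _ _ f g x 1 a b fa gb).
Qed.

Lemma is_derive_scalefun f x a c : is_derive x 1 f a ->
  is_derive x 1 (fun t => c * f t) (c * a).
Proof. by move=> fa; exact: (@is_deriveZ _ _ _ f c x 1 a fa). Qed.

Lemma is_derive_continuous f x d : is_derive x 1 f d -> {for x, continuous f}.
Proof.
by move=> fd; apply/differentiable_continuous/derivable1_diffP; exact: ex_derive.
Qed.

Lemma continuous_itv f a b : (forall x, a <= x <= b -> {for x, continuous f}) ->
  {within `[a, b], continuous f}.
Proof.
move=> cf; apply: continuous_in_subspaceT => x.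
by rewrite inE/= in_itv/= => /cf.
Qed.

Lemma mean_value f df a b : a < b ->
  (forall t, a <= t <= b -> is_derive t 1 f (df t)) ->
  exists2 c, a < c < b & f b - f a = df c * (b - a).
Proof.
move=> ab fd; have [||c cab] := @MVT _ f df _ _ ab.
- by move=> t; rewrite in_itv/= => tab; apply: fd; lra.
- by apply: continuous_itv => t /fd; exact: is_derive_continuous.
by exists c => //; move: cab; rewrite in_itv.
Qed.

Lemma point_right_of a b r : a < b -> 0 < r -> exists y, [/\ a < y, y - a < r & y < b].
Proof.
move=> ab r0; exists (a + Num.min (r / 2) ((b - a) / 2)).
by case: (leP (r / 2) ((b - a) / 2)) => ?; split; lra.
Qed.

(** If [d] were positive, [df] would be positive just to the right of its zero [c], and the mean
    value theorem would lift [f] above [f c] there. *)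
Lemma second_order_max f df a b c d : a < c < b ->
  (forall t, a < t < b -> is_derive t 1 f (df t)) -> is_derive c 1 df d ->
  (forall t, a < t < b -> f t <= f c) -> df c = 0 /\ d <= 0.
Proof.
move=> cab fd dd fmax; have /andP[ac cb] := cab.
have dc0 : df c = 0.
  have fc : is_derive c 1 f 0.
    apply: (@derive1_at_max _ _ a b); first lra.
    - by move=> t; rewrite in_itv/= => /fd tab; apply: ex_derive.
    - by rewrite in_itv.
    - by move=> t; rewrite in_itv/=; exact: fmax.
  by have := fd c cab => /@derive_val <-; rewrite derive_val.
split=> //; rewrite leNgt; apply/negP => d0.
have [|r r0 rdf] := (is_derive_epsP df c d).1 dd (d / 2); first lra.
have [y [yc yr yb]] := point_right_of cb r0.
have [t ?|z zcy fyc] := @mean_value f df c y yc; first by apply: fd; lra.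
have : f y - f c <= 0 by rewrite subr_le0; apply: fmax; lra.
rewrite fyc leNgt => /negP; apply; apply: mulr_gt0; last by rewrite subr_gt0.
have zc : `|z - c| = z - c by rewrite ger0_norm; lra.
have zr : z - c < r by lra.
have := rdf z; rewrite zc dc0 => /(_ zr).
rewrite ler_norml => /andP[h _]; have : 0 < d * (z - c) by apply: mulr_gt0; lra.
by move=> ?; lra.
Qed.

Lemma derive_lipschitz f df a b C :
  (forall t, a <= t <= b -> is_derive t 1 f (df t)) ->
  (forall t, a <= t <= b -> `|df t| <= C) ->
  forall x y, a <= x <= b -> a <= y <= b -> `|f x - f y| <= C * `|x - y|.
Proof.
move=> fd dC x y xab yab; wlog xy : x y xab yab / y <= x.
  move=> H; have [/H|/ltW/H] := leP y x; first exact.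
  by rewrite distrC (distrC x); exact.
move: xy; rewrite le_eqVlt => /predU1P[->|xy].
  by rewrite !subrr normr0 mulr0.
have [t ?|z zyx ->] := @mean_value f df _ _ xy; first by apply: fd; lra.
by rewrite normrM ler_wpM2r// dC//; lra.
Qed.

Lemma continuous_bounded_itv f a b :
  (forall x, a <= x <= b -> {for x, continuous f}) ->
  exists2 C, 0 < C & forall y, a <= y <= b -> `|f y| <= C.
Proof.
move=> cf; have [ab|ba] := leP a b; last by exists 1 => // y ?; lra.
have [|c _ fc] := @EVT_max _ (fun x => `|f x|) _ _ ab.
  apply: continuous_itv => x /cf cfx.
  by apply: (@continuous_comp _ _ _ f); [exact: cfx|exact: norm_continuous].
exists (`|f c| + 1); first by rewrite ltr_wpDl.
by move=> y yab; have := fc y; rewrite in_itv/= => /(_ yab); lra.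
Qed.

Lemma continuous_gt0_itv f a b :
  (forall x, a <= x <= b -> {for x, continuous f}) ->
  (forall y, a <= y <= b -> 0 < f y) ->
  exists2 C, 0 < C & forall y, a <= y <= b -> C <= f y.
Proof.
move=> cf f0; have [ab|ba] := leP a b; last by exists 1 => // y ?; lra.
have [c cab fc] := EVT_min ab (continuous_itv cf).
exists (f c); first by apply: f0; move: cab; rewrite in_itv.
by move=> y yab; apply: fc; rewrite in_itv.
Qed.

Lemma powR_continuous (p x : R) : 0 < x -> {for x, continuous (fun t => t `^ p)}.
Proof. by move=> x0; exact: is_derive_continuous (is_derive1_powR p x0). Qed.

Lemma powR_lipschitz (p m M : R) : 0 < m -> exists2 C, 0 < C &
  forall s t, m <= s <= M -> m <= t <= M -> `|s `^ p - t `^ p| <= C * `|s - t|.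
Proof.
move=> m0.
have [t /andP[mt _]|C C0 hC] :=
    @continuous_bounded_itv (fun t => p * t `^ (p - 1)) m M.
  apply: continuousM; first exact: cst_continuous.
  by apply: powR_continuous; exact: lt_le_trans mt.
exists C => // s t sm tm.
have pd u : m <= u <= M -> is_derive u 1 (fun t => t `^ p) (p * u `^ (p - 1)).
  by move=> /andP[mu _]; apply: is_derive1_powR; exact: lt_le_trans mu.
exact: (derive_lipschitz pd hC sm tm).
Qed.

(** Multiplying [f] by exp(C t) for t < 0 and by exp(- C t) for t > 0 gives a product that is
    monotone on each side of 0 and largest at 0. The sign [s] selects the side. *)
Lemma gronwall f df C K : 0 <= C ->
  (forall t, - K <= t <= K -> is_derive t 1 f (df t)) ->
  (forall t, - K <= t <= K -> `|df t| <= C * f t) ->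
  forall y, - K <= y <= K -> f y * expR (- C * `|y|) <= f 0.
Proof.
move=> C0 fd fC y yK.
pose g s t := f t * expR (s * C * t).
pose dg s t := (df t + s * C * f t) * expR (s * C * t).
have gd s t : - K <= t <= K -> is_derive t 1 (g s) (dg s t).
  move=> /fd ft.
  have e1 : is_derive t 1 (fun t => s * C * t) (s * C * 1).
    exact: (@is_derive_scalefun id t 1 (s * C) (is_derive_id _ _)).
  have e2 := is_derive1_comp (is_derive_expR (s * C * t)) e1.
  have := is_derive_mulfun ft e2.
  by congr is_derive; rewrite /dg /=; ring.
have [y0|y0|->] := ltgtP y 0; last by rewrite normr0 mulr0 expR0 mulr1.
- have [t ?|z zy gy] := @mean_value (g 1) (dg 1) _ _ y0; first by apply: gd; lra.
  rewrite ltr0_norm// mulrNN.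
  have -> : f y * expR (C * y) = g 1 y by rewrite /g mul1r.
  have -> : f 0 = g 1 0 by rewrite /g mulr0 expR0 mulr1.
  rewrite -subr_ge0 gy mulr_ge0//; last lra.
  rewrite mulr_ge0 ?expR_ge0// mul1r.
  by have := fC z; rewrite ler_norml => /(_ ltac:(lra)) /andP[? _]; lra.
- have [t ?|z zy gy] := @mean_value (g (-1)) (dg (-1)) _ _ y0; first by apply: gd; lra.
  rewrite gtr0_norm//.
  have -> : f y * expR (- C * y) = g (-1) y by rewrite /g mulN1r.
  have -> : f 0 = g (-1) 0 by rewrite /g mulr0 expR0 mulr1.
  rewrite -subr_le0 gy mulr_le0_ge0//; last lra.
  rewrite mulr_le0_ge0 ?expR_ge0// mulN1r.
  by have := fC z; rewrite ler_norml => /(_ ltac:(lra)) /andP[_ ?]; lra.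
Qed.

Lemma powR_le_root (x y q : R) : 0 < q -> 0 <= x -> x `^ q <= y -> x <= y `^ q^-1.
Proof.
move=> q0 x0 xy; have y0 : 0 <= y by apply: le_trans xy; exact: powR_ge0.
have -> : x = (x `^ q) `^ q^-1 by rewrite -powRrM mulfV ?gt_eqF// powRr1.
by rewrite ge0_ler_powR ?nnegrE ?powR_ge0// invr_ge0 ltW.
Qed.

Lemma powR1B (x q : R) : 0 < x -> x `^ (1 - q) = x / x `^ q.
Proof.
by move=> x0; rewrite powRB ?powRr1 ?(ltW x0)// (gt_eqF x0) implybT.
Qed.

Lemma mulr_powRB1_gt0 (x q : R) : 0 < x -> x * x `^ (q - 1) = x `^ q.
Proof.
move=> x0; rewrite -{1}(powRr1 (ltW x0)) -powRD; first by rewrite addrC subrK.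
by rewrite (gt_eqF x0) implybT.
Qed.

Lemma is_derive_expR_affine (c l s t : R) :
  is_derive t 1 (fun t => c * expR (l * (t - s))) (c * l * expR (l * (t - s))).
Proof.
have d1 : is_derive t 1 (fun t => l * (t - s)) (l * (1 - 0)).
  exact: is_derive_scalefun.
have := is_derive_scalefun c (is_derive1_comp (is_derive_expR _) d1).
by congr is_derive; rewrite subr0 mulr1 mulrAC mulrA.
Qed.

End real_analysis.

(** * Locally uniform convergence and differentiation of limits *)

Section locally_uniform_convergence.
Context {R : realType}.
Implicit Types (u v : nat -> R) (f df : nat -> R -> R) (g dg : R -> R).

Lemma cvgn_epsP u (l : R) : u @ \oo --> l <->
  forall e, 0 < e -> exists N, forall n, (N <= n)%N -> `|u n - l| <= e.
Proof.
split=> [/cvgrPdist_le ul e /ul[N _ uN]|ul].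
  by exists N => n Nn; rewrite distrC; exact: uN.
apply/cvgrPdist_le => e /ul[N uN]; exists N => // n /= Nn.
by rewrite distrC; exact: uN.
Qed.

Lemma cauchy_seq_cvg u :
  (forall e, 0 < e -> exists N, forall i j, (N <= i)%N -> (N <= j)%N ->
    `|u i - u j| <= e) ->
  exists l : R, u @ \oo --> l.
Proof.
move=> uc; suff cu : cvg (u @ \oo) by exists (lim (u @ \oo)).
apply/cauchy_cvgP/cauchy_exP => e e0; have [|N uN] := uc (e / 2); first lra.
exists (u N); exists N => // n /= Nn; rewrite /ball/=.
by apply: (le_lt_trans (uN _ _ _ _)) => //; lra.
Qed.

(** Two successive extractions. The clause [n <= f n] keeps the interval lengths along the
    subsequence tending to infinity. *)
Lemma bounded_subsequence2 u v (M : R) :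
  (forall n, `|u n| <= M) -> (forall n, `|v n| <= M) ->
  exists f : nat -> nat, exists a b : R,
    [/\ forall n, (n <= f n)%N, (u \o f) @ \oo --> a & (v \o f) @ \oo --> b].
Proof.
have bnd w : (forall n, `|w n| <= M) -> bounded_fun w.
  move=> wM; exists M; split; first exact: num_real.
  by move=> x Mx n _; exact: le_trans (wM n) (ltW Mx).
have ge_id (f : nat -> nat) : increasing_seq f -> forall n, (n <= f n)%N.
  move=> /increasing_seqP fi; elim=> // n IH.
  exact: leq_ltn_trans IH (fi n).
move=> /bnd/bolzano_weierstrass[f fi ucv] vM.
have /bnd/bolzano_weierstrass[g gi vcv] : forall n, `|(v \o f) n| <= M.
  by move=> n; exact: vM.
exists (f \o g), (lim ((u \o f) @ \oo)), (lim (((v \o f) \o g) @ \oo)).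
split=> //.
- by move=> n; apply: leq_trans (ge_id _ fi _); exact: ge_id.
- apply/cvgn_epsP => e e0; have [N uN] := (cvgn_epsP _ _).1 ucv e e0.
  by exists N => n Nn; apply: uN; exact: leq_trans (ge_id _ gi n).
Qed.

(** Symmetric windows stand for compact sets: every compact set lies in one, and each window
    eventually lies inside the intervals of the solutions. *)
Definition cvg_loc_unif f g := forall K e : R, 0 < e ->
  exists N, forall j, (N <= j)%N -> forall y, - K <= y <= K -> `|f j y - g y| <= e.

Lemma cvg_loc_unif_pointwise f g y : cvg_loc_unif f g -> f ^~ y @ \oo --> g y.
Proof.
move=> fg; apply/cvgn_epsP => e e0; have [N fN] := fg `|y| e e0.
by exists N => n Nn; apply: fN => //; rewrite -ler_norml.
Qed.

Lemma cauchy_cvg_loc_unif f :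
  (forall K e : R, 0 < e -> exists N, forall i j, (N <= i)%N -> (N <= j)%N ->
    forall y, - K <= y <= K -> `|f i y - f j y| <= e) ->
  exists g, cvg_loc_unif f g.
Proof.
move=> fc; have /choice[g fg] : forall y, exists l : R, f ^~ y @ \oo --> l.
  move=> y; apply: cauchy_seq_cvg => e e0; have [N fN] := fc `|y| e e0.
  by exists N => i j Ni Nj; apply: fN; rewrite -?ler_norml.
exists g => K e e0; have [|N fN] := fc K (e / 2); first lra.
exists N => j Nj y yK; have [|N' fN'] := (cvgn_epsP _ _).1 (fg y) (e / 2).
  lra.
have q1 := fN j (maxn N N') Nj (leq_maxl _ _) y yK.
have q2 := fN' (maxn N N') (leq_maxr _ _).
have := ler_normD (f j y - f (maxn N N') y) (f (maxn N N') y - g y).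
by rewrite addrA subrK => ?; lra.
Qed.

(** Regularity of [f j] is asked on each window only from some index on, since the solutions satisfy
    the equation on growing intervals. *)
Lemma cvg_loc_unif_derive f df g dg :
  (forall K : R, exists N, forall j, (N <= j)%N -> forall y : R, - K <= y <= K ->
    is_derive y 1 (f j) (df j y) /\ {for y, continuous (df j)}) ->
  cvg_loc_unif f g -> cvg_loc_unif df dg -> forall y : R, is_derive y 1 g (dg y).
Proof.
move=> fd fg dfdg y; apply/is_derive_epsP => e e0.
pose K := `|y| + 1.
have [N0 hd] := fd K; have [|N1 hdf] := dfdg K (e / 4); first lra.
have yK : - K <= y <= K by rewrite -ler_norml lerDl.
pose N := maxn N0 N1.
have e4 : 0 < e / 4 by lra.
(* Continuity of the single function [df N] gives one radius valid for all later indices, because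
   every such [df j] is uniformly close to [dg] near [y]. Four errors of e / 4 add up in [slope]. *)
have [r r0 hr] := (continuous_epsP _ _).1 (hd N (leq_maxl _ _) y yK).2 (e / 4) e4.
exists (Num.min r 1) => [|x]; first by rewrite lt_min r0 ltr01.
rewrite lt_min => /andP[xr x1].
have near_ok t : `|t - y| <= `|x - y| -> - K <= t <= K.
  move=> tx; rewrite -ler_norml /K.
  by have := ler_normD (t - y) y; rewrite subrK; lra.
have key j : (N <= j)%N ->
    `|f j x - f j y - dg y * (x - y)| <= e * `|x - y|.
  rewrite geq_max => /andP[N0j N1j].
  have slope t : `|t - y| <= `|x - y| -> `|df j t - dg y| <= e.
    move=> tx; have tK := near_ok t tx.
    have q1 := hdf j N1j t tK.
    have q2 := hdf N (leq_maxr _ _) t tK.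
    have q3 := hdf N (leq_maxr _ _) y yK.
    have q4 := hr t (le_lt_trans tx xr).
    have -> : df j t - dg y = (df j t - dg t) - (df N t - dg t) +
        (df N t - df N y) + (df N y - dg y) by ring.
    apply: (le_trans (ler_normD _ _)); rewrite [e](_ : _ = e * 3/4 + e / 4); last lra.
    apply: lerD => //; apply: (le_trans (ler_normD _ _)).
    rewrite [_ * 3 / 4](_ : _ = e / 2 + e / 4); last lra.
    apply: lerD; last exact: ltW.
    by apply: (le_trans (ler_normB _ _)); lra.
  have [->|xy] := eqVneq x y; first by rewrite !subrr !mulr0 subrr normr0 mulr0.
  have [z zxy ->] : exists2 z, `|z - y| <= `|x - y| &
      f j x - f j y = df j z * (x - y).
    have [yx|xy'] := ltP y x.
      have [t ty|z zy ->] := @mean_value _ (f j) (df j) y x yx.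
        by apply: (hd _ N0j _ (near_ok _ _)).1; rewrite !ger0_norm; lra.
      by exists z => //; rewrite !ger0_norm; lra.
    have {}xy' : x < y by rewrite lt_neqAle xy.
    have [t ty|z zy hz] := @mean_value _ (f j) (df j) x y xy'.
      by apply: (hd _ N0j _ (near_ok _ _)).1; rewrite !ler0_norm; lra.
    exists z => //; first by rewrite !ler0_norm; lra.
    by rewrite -[LHS]opprB hz -mulrN opprB.
  by rewrite -mulrBl normrM ler_wpM2r// slope.
(* The bound in [key] is uniform in [j], so it passes to the limit: an excess would survive the two
   pointwise errors, each at most a quarter of it. *)
rewrite leNgt; apply/negP => hlt.
pose d := (`|g x - g y - dg y * (x - y)| - e * `|x - y|) / 4.
have d0 : 0 < d by rewrite /d; lra.
have [N2 hx] := (cvgn_epsP _ _).1 (@cvg_loc_unif_pointwise f g x fg) d d0.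
have [N3 hy] := (cvgn_epsP _ _).1 (@cvg_loc_unif_pointwise f g y fg) d d0.
pose j := maxn N (maxn N2 N3).
have q1 := key j (leq_maxl _ _).
have q2 := hx j (leq_trans (leq_maxl N2 N3) (leq_maxr _ _)).
have q3 := hy j (leq_trans (leq_maxr N2 N3) (leq_maxr _ _)).
have := ler_normD (f j x - f j y - dg y * (x - y)) ((f j y - g y) - (f j x - g x)).
have := ler_normB (f j y - g y) (f j x - g x).
have -> : f j x - f j y - dg y * (x - y) + (f j y - g y - (f j x - g x)) =
  g x - g y - dg y * (x - y) by ring.
by rewrite /d in q2 q3 d0 *; lra.
Qed.

Lemma cvg_loc_unif_uniform f g (A : set R) : cvg_loc_unif f g -> compact A ->
  {uniform A, f @ \oo --> g}.
Proof.
move=> fg /compact_bounded[M [_ AM]] P /uniform_nbhs[E [entE EP]].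
move: entE; rewrite -entourage_ballE => -[e /= e0 eE].
have [|N fN] := fg (M + 1) (e / 2); first lra.
exists N => // j Nj; apply: EP => y Ay; apply: eE => /=.
have yM : `|y| <= M + 1 by apply: (AM (M + 1)) => //; rewrite ltrDl.
rewrite /ball/= distrC; apply: le_lt_trans (fN j Nj y _) _; last lra.
by rewrite -ler_norml.
Qed.

End locally_uniform_convergence.

(** * Contact of a function with a multiple of another *)

Section touching.
Context {R : realType}.
Implicit Types (w dw ddw h dh ddh : R -> R) (a b c y : R).

Definition twice_derivable h dh ddh y :=
  is_derive y 1 h (dh y) /\ is_derive y 1 dh (ddh y).

Lemma touching_above w dw ddw h dh ddh a b c y : a < y < b ->
  (forall t, a < t < b -> twice_derivable w dw ddw t) ->
  (forall t, a < t < b -> twice_derivable h dh ddh t) ->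
  (forall t, a < t < b -> w t <= c * h t) -> w y = c * h y ->
  dw y = c * dh y /\ ddw y <= c * ddh y.
Proof.
move=> yab wd hd wh why.
have d1 t : a < t < b ->
    is_derive t 1 (fun t => w t - c * h t) (dw t - c * dh t).
  move=> tab; have [wt _] := wd t tab; have [ht _] := hd t tab.
  exact: is_derive_subfun wt (is_derive_scalefun c ht).
have d2 : is_derive y 1 (fun t => dw t - c * dh t) (ddw y - c * ddh y).
  have [_ wt] := wd y yab; have [_ ht] := hd y yab.
  exact: is_derive_subfun wt (is_derive_scalefun c ht).
have [|e1 e2] := second_order_max yab d1 d2.
  by move=> t /wh tab; rewrite why subrr subr_le0.
by split; lra.
Qed.

Lemma continuous_ratio w h a b :
  {within `[a, b], continuous w} -> {within `[a, b], continuous h} ->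
  (forall y, a <= y <= b -> 0 < h y) ->
  {within `[a, b], continuous (fun y => w y / h y)}.
Proof.
move=> /subspace_continuousP cw /subspace_continuousP ch h0.
apply/subspace_continuousP => y yab.
have hy0 : h y != 0 by rewrite gt_eqF// h0//; move: yab; rewrite /= in_itv.
exact: (cvgM (cw y yab) (cvgV hy0 (ch y yab))).
Qed.

(** The maximal quotient is the least factor for which the multiple of [h] lies above [w]; the
    division by [h t] is cleared to match [touching_above]. *)
Lemma ratio_max w h a b : a <= b ->
  {within `[a, b], continuous w} -> {within `[a, b], continuous h} ->
  (forall y, a <= y <= b -> 0 < h y) ->
  exists2 y, a <= y <= b & forall t, a <= t <= b -> w t <= w y / h y * h t.
Proof.
move=> ab cw ch h0; have [y yab ymax] := EVT_max ab (continuous_ratio cw ch h0).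
exists y; first by move: yab; rewrite in_itv.
move=> t tab; rewrite -ler_pdivrMr ?h0//.
by apply: ymax; rewrite in_itv.
Qed.

End touching.

(** * The Dirichlet problem on [[- L, L]]: bounds independent of [L] *)

Section semilinear_equation.
Context {R : realType} (A b k : R -> R) (eta p kl : R).
Implicit Types (h dh ddh w dw ddw : R -> R) (y c L K : R).

(** The derivatives are arguments: barriers bring explicit formulas for them, and the limit function
    brings the limits of h' and h''. *)
Definition elliptic h dh ddh y := A y / 2 * ddh y + b y * dh y - k y * h y.

Record dirichlet_solution L h dh ddh : Prop := DirichletSolution {
  sol_derivable : forall y, - L < y < L -> twice_derivable h dh ddh y ;
  sol_derive2_continuous : forall y, - L < y < L -> {for y, continuous ddh} ;
  sol_continuous : {within `[- L, L], continuous h} ;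
  sol_ge0 : forall y, - L <= y <= L -> 0 <= h y ;
  sol_gt0_singular : p < 0 -> forall y, - L < y < L -> 0 < h y ;
  sol_equation : forall y, - L < y < L -> elliptic h dh ddh y + eta * h y `^ p = 0 ;
  sol_left : h (- L) = (k (- L))^-1 ;
  sol_right : h L = (k L)^-1 }.

Record regular_coefficients : Prop := RegularCoefficients {
  coef_A_gt0 : forall y, 0 < A y ;
  coef_A_continuous : continuous A ;
  coef_b_continuous : continuous b ;
  coef_k_continuous : continuous k ;
  coef_kl_gt0 : 0 < kl ;
  coef_k_ge : forall y, kl <= k y ;
  coef_eta_gt0 : 0 < eta ;
  coef_p_lt1 : p < 1 }.

Hypothesis coef : regular_coefficients.
Let A_gt0 := coef_A_gt0 coef.
Let A_cont := coef_A_continuous coef.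
Let b_cont := coef_b_continuous coef.
Let k_cont := coef_k_continuous coef.
Let kl_gt0 := coef_kl_gt0 coef.
Let k_ge := coef_k_ge coef.
Let eta_gt0 := coef_eta_gt0 coef.
Let p_lt1 := coef_p_lt1 coef.

Let k_gt0 y : 0 < k y. Proof. exact: lt_le_trans (k_ge y). Qed.

Definition sol_bound : R := Num.max kl^-1 ((eta / kl) `^ (1 - p)^-1).

(** At a positive interior maximum the equation leaves kl h <= eta h^p, that is h^(1 - p) <= eta /
    kl; at the endpoints the data are at most 1 / kl. These are the two entries of [sol_bound]. *)
Lemma sol_le L h dh ddh y : 0 < L -> dirichlet_solution L h dh ddh ->
  - L <= y <= L -> h y <= sol_bound.
Proof.
move=> L0 hs yL; have [|c] := @EVT_max _ h (- L) L _ (sol_continuous hs); first lra.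
rewrite in_itv/= => cL cmax.
have {yL} /le_trans -> // : h y <= h c by apply: cmax; rewrite in_itv.
rewrite /sol_bound le_max.
have kV z : (k z)^-1 <= kl^-1 by rewrite lef_pV2 ?posrE.
have [->|cNL] := eqVneq c (- L); first by rewrite (sol_left hs) kV.
have [->|cNR] := eqVneq c L; first by rewrite (sol_right hs) kV.
have cL' : - L < c < L by rewrite !lt_neqAle cNR eq_sym cNL.
apply/orP; right; have := sol_ge0 hs cL; rewrite le_eqVlt => /predU1P[<-|hc0].
  exact: powR_ge0.
apply: powR_le_root; [by rewrite subr_gt0|exact: ltW|].
have d1 t : - L < t < L -> is_derive t 1 h (dh t).
  by move=> tL; exact: (sol_derivable hs tL).1.
have [|h1 h2] := second_order_max cL' d1 (sol_derivable hs cL').2.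
  by move=> t tL; apply: cmax; rewrite in_itv/=; lra.
have := sol_equation hs cL'; rewrite /elliptic h1 mulr0 addr0 => eq.
have A2 : A c / 2 * ddh c <= 0.
  by apply: mulr_ge0_le0 => //; rewrite divr_ge0// ltW.
have klk : kl * h c <= k c * h c by rewrite ler_pM2r.
rewrite powR1B// ler_pdivrMr ?powR_gt0// mulrAC ler_pdivlMr// mulrC; lra.
Qed.

Lemma local_constants K : exists a0 C, [/\ 0 < a0, 0 < C &
  forall y, - K <= y <= K -> [/\ a0 <= A y, A y <= C, `|b y| <= C & k y <= C]].
Proof.
have [y _|y _|a0 a00 ha] := @continuous_gt0_itv _ A (- K) K.
- exact: A_cont.
- exact: A_gt0.
have [y _|C1 C10 h1] := @continuous_bounded_itv _ A (- K) K; first exact: A_cont.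
have [y _|C2 C20 h2] := @continuous_bounded_itv _ b (- K) K; first exact: b_cont.
have [y _|C3 C30 h3] := @continuous_bounded_itv _ k (- K) K; first exact: k_cont.
exists a0, (C1 + C2 + C3); split => //; first by rewrite !addr_gt0.
move=> y yK; split; first exact: ha.
- have := h1 _ yK; rewrite ler_norml; lra.
- have := h2 _ yK; lra.
- have := h3 _ yK; rewrite ler_norml; lra.
Qed.


(* Hopf's barrier [eps * (expR (l * (t - y)) - 1)] at an interior zero [y]. *)
Lemma sol_gt0 L h dh ddh y : dirichlet_solution L h dh ddh -> - L <= y <= L ->
  0 < h y.
Proof.
move=> hs yL; have hL : 0 < h L by rewrite (sol_right hs) invr_gt0.
have [->|yNL] := eqVneq y (- L); first by rewrite (sol_left hs) invr_gt0.
have [->//|yNR] := eqVneq y L.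
have yL' : - L < y < L by rewrite !lt_neqAle yNR eq_sym yNL.
have := sol_ge0 hs yL; rewrite le_eqVlt => /predU1P[/esym hy0|//].
have dhy : dh y = 0.
  have [t _|t /andP[t1 t2]||->] := @touching_above _ (fun=> 0) (fun=> 0) (fun=> 0)
      h dh ddh (- L) L 1 y yL' _ (sol_derivable hs).
  - by split; exact: is_derive_cst.
  - by rewrite mul1r; apply: (sol_ge0 hs); rewrite !ltW.
  - by rewrite hy0 mulr0.
  - by rewrite mul1r.
have [a0 [C [a00 C0 hC]]] := local_constants L.
(* Large enough for A l^2 / 2 to absorb b l and k: A l^2 / 2 >= 2 C l, while |b| l <= C l and k <= C
   <= C l. *)
pose l := 1 + 4 * C / a0.
have l1 : 1 <= l by rewrite lerDl divr_ge0 ?mulr_ge0 ?ltW.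
have la : a0 * l = a0 + 4 * C by rewrite /l mulrDr mulr1 mulrCA divff ?gt_eqF ?mulr1.
(* Normalised so that w(L) = h(L) - e, strictly below h(L). *)
pose e := h L / expR (l * (L - y)).
have e0 : 0 < e by rewrite divr_gt0 ?expR_gt0.
pose E t := expR (l * (t - y)).
pose w t := e * E t - e.
pose dw t := e * l * E t.
pose ddw t := e * l * l * E t.
have wd t : twice_derivable w dw ddw t.
  split; last exact: is_derive_expR_affine.
  have := is_derive_subfun (is_derive_expR_affine e l y t) (is_derive_cst e t 1).
  by rewrite subr0.
have ellw t : - L <= t <= L -> 0 < elliptic w dw ddw t.
  move=> tL; have [h1 h2 h3 h4] := hC t tL.
  have -> : elliptic w dw ddw t =
      e * E t * (A t / 2 * l * l + b t * l - k t) + k t * e.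
    by rewrite /elliptic /w /dw /ddw; ring.
  apply: ltr_wpDl; last by rewrite mulr_gt0.
  rewrite mulr_ge0//; first by rewrite mulr_ge0 ?expR_ge0 ?ltW.
  have h5 : - C <= b t by move: h3; rewrite ler_norml => /andP[].
  have h6 : (a0 + 4 * C) * l <= A t * l * l.
    by rewrite -la; do 2 (apply: ler_wpM2r; first lra).
  have h7 : - C * l <= b t * l by rewrite ler_wpM2r//; lra.
  have h8 : 0 <= a0 * l by rewrite mulr_ge0//; lra.
  have h9 : C <= C * l by rewrite ler_peMr// ltW.
  by lra.
(* Linear maximum principle: the power term is nonnegative, so [h] is a supersolution of the linear
   part, and a positive interior maximum of w - h would force elliptic w < elliptic h <= 0, against
   [ellw]. *)
have wh t : y <= t <= L -> w t <= h t.
  have yleL : y <= L by lra.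
  have [|c] := @EVT_max _ (fun t => w t - h t) y L yleL.
    have ch : {within `[y, L], continuous h}.
      apply: continuous_subspaceW (sol_continuous hs).
      by apply: subset_itv; rewrite bnd_simp//; lra.
    have cw : {within `[y, L], continuous w}.
      by apply: continuous_itv => s _; exact: is_derive_continuous (wd s).1.
    by move=> s; exact: cvgB (cw s) (ch s).
  rewrite in_itv/= => cL cmax tL; rewrite -subr_le0.
  apply: (@le_trans _ _ (w c - h c)); first by apply: cmax; rewrite in_itv.
  rewrite leNgt; apply/negP => whc.
  have [cy|cy] := eqVneq c y.
    by move: whc; rewrite cy hy0 /w /E subrr mulr0 expR0; lra.
  have [cLL|cLL] := eqVneq c L.
    have := whc; rewrite cLL /w /e /E divfK ?gt_eqF ?expR_gt0//.
    by rewrite -/(E L) -/e; lra.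
  have cyL : y < c < L.
    by rewrite !lt_neqAle cLL eq_sym cy.
  have cL' : - L < c < L by lra.
  have [|||e1 e2] := @second_order_max _ (fun t => w t - h t) (fun t => dw t - dh t)
      y L c (ddw c - ddh c) cyL.
  - move=> s syL; apply: is_derive_subfun (wd s).1 _.
    by apply: (proj1 (sol_derivable hs _)); lra.
  - exact: is_derive_subfun (wd c).2 (sol_derivable hs cL').2.
  - by move=> s syL; apply: cmax; rewrite in_itv/=; lra.
  have cLe : - L <= c <= L by lra.
  have := ellw c cLe; have := sol_equation hs cL'; rewrite /elliptic => q1 q2.
  have q3 : 0 <= eta * h c `^ p by rewrite mulr_ge0 ?powR_ge0 ?ltW.
  have q4 : A c / 2 * (ddw c - ddh c) <= 0.
    by rewrite mulr_ge0_le0// divr_ge0// ltW.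
  have q5 : 0 < k c * (w c - h c) by rewrite mulr_gt0.
  have q6 : b c * (dw c - dh c) = 0 by rewrite e1 mulr0.
  by lra.
(* Both functions vanish at [y], but w'(y) > 0 = h'(y): [w] exceeds [h] just to the right of [y],
   contradicting [wh]. *)
have dwh : is_derive y 1 (fun t => w t - h t) (dw y - dh y).
  exact: is_derive_subfun (wd y).1 (sol_derivable hs yL').1.
have dw0 : 0 < dw y.
  have l0 : 0 < l by exact: lt_le_trans l1.
  by apply: mulr_gt0; [exact: mulr_gt0|exact: expR_gt0].
have [|r r0 hr] := (is_derive_epsP _ _ _).1 dwh (dw y / 2); first lra.
have /andP[_ yltL] := yL'.
have [s [sy sr sL]] := point_right_of yltL r0.
have sy' : `|s - y| = s - y by rewrite ger0_norm// subr_ge0 ltW.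
have sr' : `|s - y| < r by rewrite sy'.
have := hr s sr'; rewrite sy' dhy subr0 ler_norml => /andP[h1 _].
have := wh s; rewrite (ltW sy) (ltW sL).
move=> /(_ isT) h2; have h3 : 0 < dw y * (s - y) by rewrite mulr_gt0// subr_gt0.
have h4 : w y = 0 by rewrite /w /E subrr mulr0 expR0 mulr1 subrr.
by lra.
Qed.

(* Interior lower bound, by sliding [zeta ^ 2 / c] with
   [zeta t = K ^ 2 - t ^ 2] under the solution: the square makes the second
   derivative positive near the zeros of [zeta], hence the contact point stays
   away from them. *)
Lemma sol_lower_local J : 0 <= J -> exists2 m : R, 0 < m &
  forall L h dh ddh y, J + 1 < L -> dirichlet_solution L h dh ddh ->
    - J <= y <= J -> m <= h y.
Proof.
move=> J0; pose K := J + 1; have K1 : 1 <= K by rewrite /K; lra.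
have [a0 [C [a00 C0 hC]]] := local_constants K.
have e0 := eta_gt0; have p1 := p_lt1.
(* The coefficient of [zeta c] in [key]: the three terms come from A W'' / 2, b W' and k W. *)
pose Q := 6 * C + 4 * C * K + C * K ^+ 2.
have K0 : 0 < K by lra.
have KK : 0 < K ^+ 2 by rewrite exprn_gt0.
have Q0 : 0 < Q.
  have := mulr_gt0 C0 KK; have := mulr_gt0 C0 (lt_le_trans ltr01 K1).
  by rewrite /Q; lra.
(* The left side of [key] is positive, which forces [zeta c >= z0]. This floor matters because the
   exponent [1 - 2 * p] below may be negative. *)
pose z0 := 4 * a0 * K ^+ 2 / Q.
have z00 : 0 < z0 by rewrite /z0 divr_gt0// !mulr_gt0.
have [t /andP[t0 _]|D D0 hD] :=
    @continuous_bounded_itv _ (fun t => t `^ (1 - 2 * p)) z0 (K ^+ 2).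
  by apply: powR_continuous; exact: lt_le_trans t0.
pose cm := (Q / eta * D) `^ (1 - p)^-1.
have cm0 : 0 < cm by rewrite /cm powR_gt0// mulr_gt0// divr_gt0.
exists cm^-1; first by rewrite invr_gt0.
move=> L h dh ddh y JL hs yJ.
pose zeta : R -> R := fun t => K ^+ 2 - t ^+ 2.
pose W : R -> R := fun t => zeta t * zeta t.
pose dW : R -> R := fun t => - 4 * (t * zeta t).
pose ddW : R -> R := fun t => 8 * t ^+ 2 - 4 * zeta t.
have dz (t : R) : is_derive t 1 zeta (- 2 * t).
  have := is_derive_subfun (is_derive_cst (K ^+ 2) t 1)
    (is_derive_mulfun (is_derive_id t 1) (is_derive_id t 1)).
  by congr is_derive; rewrite /=; ring.
have Wd (t : R) : twice_derivable W dW ddW t.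
  split.
    by have := is_derive_mulfun (dz t) (dz t); congr is_derive; rewrite /dW; ring.
  have := is_derive_scalefun (- 4) (is_derive_mulfun (is_derive_id t 1) (dz t)).
  by congr is_derive; rewrite /ddW /=; ring.
have KL t : - K <= t <= K -> - L <= t <= L by rewrite /K; lra.
have hK0 t : - K <= t <= K -> 0 < h t by move=> /KL; exact: (sol_gt0 hs).
have zK t : - K <= t <= K -> 0 <= zeta t.
  move=> tK; have -> : zeta t = (K - t) * (K + t) by rewrite /zeta; ring.
  have /andP[tl tr] := tK.
  by rewrite mulr_ge0 ?subr_ge0// -(opprK K) addrC subr_ge0.
have [||||c cK hc] := @ratio_max _ W h (- K) K.
- lra.
- by apply: continuous_itv => t _; exact: is_derive_continuous (Wd t).1.
- apply: continuous_subspaceW (sol_continuous hs).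
  by apply: subset_itv; rewrite bnd_simp /K; lra.
- exact: hK0.
set r := W c / h c in hc.
have hc0 := hK0 c cK.
have r0 : 0 < r.
  have z : - K <= 0 <= K by lra.
  rewrite -(pmulr_lgt0 _ (hK0 0 z)); apply: lt_le_trans (hc 0 z).
  by rewrite /W /zeta expr0n subr0 mulr_gt0.
have Whc : W c = r * h c by rewrite /r divfK// gt_eqF.
have zc0 : 0 < zeta c.
  rewrite lt_neqAle zK// andbT; apply/eqP => z; have : 0 < W c.
    by rewrite Whc mulr_gt0.
  by rewrite /W -z mul0r ltxx.
have cKK : - K < c < K.
  have cNl : c != - K.
    by apply: contraTneq zc0 => ->; rewrite /zeta sqrrN subrr ltxx.
  have cNr : c != K by apply: contraTneq zc0 => ->; rewrite /zeta subrr ltxx.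
  by have /andP[c1 c2] := cK; rewrite !lt_neqAle cNr eq_sym cNl c1.
have KLo t : - K < t < K -> - L < t < L by rewrite /K; lra.
have hd t : - K < t < K -> twice_derivable h dh ddh t.
  by move=> /KLo; exact: (sol_derivable hs).
have [|e1 e2] := touching_above cKK (fun t _ => Wd t) hd _ Whc.
  by move=> t tK; apply: hc; lra.
have eqh := sol_equation hs (KLo _ cKK); rewrite /elliptic in eqh.
have [h1 h2 h3 h4] := hC c cK.
set P := h c `^ p in eqh.
have P0 : 0 < P by rewrite powR_gt0.
have key : r * (eta * P) <= Q * zeta c - 4 * a0 * K ^+ 2.
  have A2 : A c / 2 * ddW c <= A c / 2 * (r * ddh c).
    by rewrite ler_wpM2l// divr_ge0// ltW.
  have q0 : r * (eta * P) <= - (A c / 2 * ddW c + b c * dW c - k c * W c).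
    have q : r * (A c / 2 * ddh c + b c * dh c - k c * h c + eta * P) = 0.
      by rewrite eqh mulr0.
    by rewrite e1 Whc; lra.
  apply: (le_trans q0).
  have c2 : c ^+ 2 = K ^+ 2 - zeta c by rewrite /zeta; ring.
  rewrite /ddW /dW /W c2.
  have zcK : zeta c <= K ^+ 2 by rewrite /zeta lerBlDr lerDl sqr_ge0.
  have A1 : a0 * K ^+ 2 <= A c * K ^+ 2 by rewrite ler_wpM2r// ltW.
  have A3 : A c * zeta c <= C * zeta c by rewrite ler_wpM2r// ltW.
  have bc : b c * c * zeta c <= C * K * zeta c.
    apply: ler_wpM2r; first exact: ltW.
    apply: (le_trans (ler_norm _)); rewrite normrM ler_pM//.
    by rewrite ler_norml; have /andP[-> ->] := cK.
  have k1 : k c * (zeta c * zeta c) <= C * K ^+ 2 * zeta c.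
    rewrite mulrA ler_wpM2r//; first exact: ltW.
    by rewrite ler_pM// ltW.
  have z1 : 0 < zeta c := zc0.
  by rewrite /Q; lra.
have zz0 : z0 <= zeta c.
  rewrite ler_pdivrMr// [_ * Q]mulrC -subr_ge0.
  by apply: le_trans key; exact: ltW (mulr_gt0 r0 (mulr_gt0 e0 P0)).
have zcK : zeta c <= K ^+ 2 by rewrite /zeta lerBlDr lerDl sqr_ge0.
have rcm : r <= cm.
  apply: powR_le_root; [by rewrite subr_gt0|exact: ltW|].
  (* At the contact h(c) = W(c) / r, which turns [key] into r^(1 - p) <= (Q / eta) zeta(c)^(1 - 2
     p). *)
  have PW : P = (zeta c `^ (2 * p)) / r `^ p.
    have hcE : h c = W c / r by rewrite Whc mulrC mulKf// gt_eqF.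
    rewrite /P hcE powRM ?invr_ge0 ?(ltW r0)//; last by rewrite mulr_ge0 ?zK.
    rewrite /W -expr2 -powR_mulrn ?zK// -powRrM; congr (_ * _).
    rewrite -(powR_inv1 (ltW r0)).
    by rewrite -powRrM mulN1r powRN.
  have k2 : r * (eta * P) <= Q * zeta c.
    by apply: (le_trans key); rewrite gerBl ltW// !mulr_gt0.
  rewrite powR1B//.
  have z2p : 0 < zeta c `^ (2 * p) by rewrite powR_gt0.
  have : r / r `^ p <= Q / eta * zeta c `^ (1 - 2 * p).
    rewrite powR1B//.
    rewrite mulrACA -invfM ler_pdivlMr ?mulr_gt0//.
    by apply: le_trans k2; rewrite PW le_eqVlt; apply/orP; left; apply/eqP; ring.
  move=> /le_trans; apply; rewrite ler_wpM2l ?divr_ge0 ?(ltW Q0) ?(ltW e0)//.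
  by apply: (le_trans (ler_norm _)); apply: hD; rewrite zz0.
have yK : - K <= y <= K by rewrite /K; lra.
(* The margin K = J + 1 makes [zeta] at least 1 on [[- J, J]], so W >= 1 there and [h] is at least 1
   / r. *)
have zy1 : 1 <= zeta y.
  have -> : zeta y = 1 + 2 * J + (J - y) * (J + y) by rewrite /zeta /K; ring.
  have /andP[yl yr] := yJ.
  rewrite -addrA lerDl addr_ge0 ?mulr_ge0 ?subr_ge0//.
  by rewrite -(opprK J) addrC subr_ge0.
rewrite -(ler_pM2l cm0) mulfV ?gt_eqF//.
apply: (@le_trans _ _ (r * h y)); last by rewrite ler_wpM2r// ltW// hK0.
apply: le_trans (hc y yK); rewrite /W.
by apply: mulr_ege1.
Qed.

(** * The explicit equation: derivative bound, stability, passage to the limit *)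

Definition rhs y u v := 2 / A y * (k y * u - eta * u `^ p - b y * v).

Lemma equation_rhs h dh ddh y : elliptic h dh ddh y + eta * h y `^ p = 0 ->
  ddh y = rhs y (h y) (dh y).
Proof.
rewrite /elliptic /rhs => eq.
have A0 : A y != 0 by rewrite gt_eqF.
have -> : k y * h y - eta * h y `^ p - b y * dh y = A y / 2 * ddh y by lra.
by field.
Qed.

Lemma rhs_lipschitz K (m N : R) : 0 < m -> exists2 C : R, 0 < C &
  forall y u u' v v', - K <= y <= K -> m <= u <= N -> m <= u' <= N ->
    `|rhs y u v - rhs y u' v'| <= C * (`|u - u'| + `|v - v'|).
Proof.
move=> m0; have [a0 [C [a00 C0 hC]]] := local_constants K.
have [P P0 hP] := @powR_lipschitz _ p m N m0.
have e0 := eta_gt0.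
exists (2 / a0 * (C + eta * P)).
  by rewrite mulr_gt0 ?divr_gt0// addr_gt0// mulr_gt0.
move=> y u u' v v' yK uN uN'; have [h1 h2 h3 h4] := hC y yK.
have A0 := A_gt0 y; have k0 := k_gt0 y.
have -> : rhs y u v - rhs y u' v' = 2 / A y *
    (k y * (u - u') - eta * (u `^ p - u' `^ p) - b y * (v - v')).
  by rewrite /rhs; ring.
rewrite normrM -[leRHS]mulrA ler_pM//.
  rewrite ger0_norm ?divr_ge0 ?(ltW A0)// ler_pM2l// lef_pV2 ?posrE//.
have n0 := normr_ge0 (u - u'); have n1 := normr_ge0 (v - v').
apply: (@le_trans _ _ (C * `|u - u'| + eta * (P * `|u - u'|) + C * `|v - v'|)).
  apply: (le_trans (ler_normB _ _)); apply: lerD.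
    apply: (le_trans (ler_normB _ _)); apply: lerD.
      by rewrite normrM ler_wpM2r// gtr0_norm.
    by rewrite normrM (gtr0_norm e0) ler_pM2l// hP.
  by rewrite normrM ler_wpM2r.
have : 0 <= eta * P * `|v - v'| by rewrite mulr_ge0 ?(ltW (mulr_gt0 e0 P0)).
by move=> ?; lra.
Qed.

Lemma rhs_bound K (m N : R) : 0 < m -> exists2 C : R, 0 < C &
  forall y u v, - K <= y <= K -> m <= u <= N -> `|rhs y u v| <= C * (1 + `|v|).
Proof.
move=> m0; have [a0 [C [a00 C0 hC]]] := local_constants K.
have [t /andP[t0 _]|P P0 hP] := @continuous_bounded_itv _ (fun t => t `^ p) m N.
  by apply: powR_continuous; exact: lt_le_trans t0.
have e0 := eta_gt0.
exists (2 / a0 * (C * `|N| + eta * P + C)).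
  rewrite mulr_gt0 ?divr_gt0//.
  have := mulr_gt0 e0 P0; have : 0 <= C * `|N| by rewrite mulr_ge0 ?(ltW C0).
  by move=> ? ?; lra.
move=> y u v yK uN; have [h1 h2 h3 h4] := hC y yK.
have A0 := A_gt0 y; have k0 := k_gt0 y.
rewrite /rhs normrM -[leRHS]mulrA ler_pM//.
  rewrite ger0_norm ?divr_ge0 ?(ltW A0)// ler_pM2l// lef_pV2 ?posrE//.
have n1 := normr_ge0 v.
apply: (@le_trans _ _ (C * `|N| + eta * P + C * `|v|)).
  apply: (le_trans (ler_normB _ _)); apply: lerD.
    apply: (le_trans (ler_normB _ _)); apply: lerD.
      rewrite normrM ler_pM//; first by rewrite gtr0_norm.
      rewrite ger0_norm; last lra.
      by apply: (le_trans _ (ler_norm _)); lra.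
    by rewrite normrM (gtr0_norm e0) ler_pM2l// hP.
  by rewrite normrM ler_wpM2r.
have : 0 <= (C * `|N| + eta * P) * `|v|.
  rewrite mulr_ge0// addr_ge0 ?(ltW (mulr_gt0 e0 P0))//.
  by rewrite mulr_ge0 ?(ltW C0).
by move=> ?; lra.
Qed.

(** Interpolation between h and h'': on an interval of length d some point has |h'| <= sol_bound /
    d, and from there h' changes by at most d C (1 + max |h'|), which is absorbed when d C < 1/2. *)
Lemma sol_derivative_local K : 0 <= K -> exists2 D : R, 0 < D &
  forall L h dh ddh y, K + 2 < L -> dirichlet_solution L h dh ddh ->
    - K <= y <= K -> `|dh y| <= D.
Proof.
move=> K0; have [|m m0 hm] := @sol_lower_local (K + 1).
  by lra.
have [C C0 hC] := @rhs_bound (K + 1) m sol_bound m0.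
(* Gives d C = 1/2 - d and d <= 1, so [[y, y + d]] stays in the window of radius K + 1. *)
pose d := (2 * C + 2)^-1.
have dC : d * (2 * C + 2) = 1 by rewrite /d mulVf// gt_eqF//; lra.
have d0 : 0 < d by rewrite /d invr_gt0; lra.
have dC0 : 0 < d * C by rewrite mulr_gt0.
have d1 : d <= 1 by lra.
have M0 : 0 <= sol_bound by rewrite /sol_bound le_max invr_ge0 (ltW kl_gt0).
exists (2 * (sol_bound / d + C * d) + 1).
  have : 0 <= sol_bound / d by rewrite divr_ge0 ?(ltW d0).
  by move=> ?; lra.
move=> L h dh ddh y KL hs yK.
have L0 : 0 < L by lra.
have yd : y <= y + d by lra.
have inK t : y <= t <= y + d -> - (K + 1) <= t <= K + 1 by lra.
have inL t : y <= t <= y + d -> - L < t < L by lra.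
have d1h t : y <= t <= y + d -> is_derive t 1 h (dh t).
  by move=> /inL tL; exact: (sol_derivable hs tL).1.
have d2h t : y <= t <= y + d -> is_derive t 1 dh (ddh t).
  by move=> /inL tL; exact: (sol_derivable hs tL).2.
have hmM t : y <= t <= y + d -> m <= h t <= sol_bound.
  move=> td; apply/andP; split.
    by apply: (hm L h dh ddh) => //; [lra|exact: inK].
  by apply: (sol_le L0 hs); have := inL t td; lra.
have [|z] := @EVT_max _ (fun t => `|dh t|) y (y + d) yd.
  apply: continuous_itv => t /d2h/is_derive_continuous cd.
  by apply: (@continuous_comp _ _ _ dh); [exact: cd|exact: norm_continuous].
rewrite in_itv/= => zd zmax.
have ylt : y < y + d by lra.
have [x /andP[x1 x2]] := mean_value ylt d1h.
rewrite addrAC subrr add0r => hx.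
have dhx : `|dh x| <= sol_bound / d.
  rewrite ler_pdivlMr// -[X in _ * X](gtr0_norm d0) -normrM -hx ler_norml.
  have := hmM (y + d); have := hmM y; rewrite !lexx yd => /(_ isT) q1 /(_ isT) q2.
  by lra.
have ddhb t : y <= t <= y + d -> `|ddh t| <= C * (1 + `|dh z|).
  move=> td; rewrite (equation_rhs (sol_equation hs (inL t td))).
  apply: (le_trans (hC _ _ _ (inK t td) (hmM t td))).
  by rewrite ler_pM2l// lerD2l; apply: zmax; rewrite in_itv.
have xd : y <= x <= y + d by lra.
have := derive_lipschitz d2h ddhb zd xd.
have zx : `|z - x| <= d by rewrite ler_norml; lra.
have zC0 : 0 <= C * (1 + `|dh z|) by rewrite mulr_ge0 ?addr_ge0 ?(ltW C0).
move=> /le_trans /(_ (ler_wpM2l zC0 zx)) zxd.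
have tri : `|dh z| <= `|dh z - dh x| + `|dh x|.
  by rewrite -{1}(subrK (dh x) (dh z)) ler_normD.
have half : d * C * `|dh z| <= 2^-1 * `|dh z| by rewrite ler_wpM2r//; lra.
have yz : `|dh y| <= `|dh z| by apply: zmax; rewrite in_itv/= lexx yd.
by lra.
Qed.

(** On the common window both functions solve the same initial value problem, with values where
    [rhs] is Lipschitz, so the two intervals may differ. *)
Lemma sol_stability K : 0 <= K -> exists2 C : R, 0 < C &
  forall L1 h1 dh1 ddh1 L2 h2 dh2 ddh2 y, K + 2 < L1 -> K + 2 < L2 ->
    dirichlet_solution L1 h1 dh1 ddh1 -> dirichlet_solution L2 h2 dh2 ddh2 ->
    - K <= y <= K ->
    `|h1 y - h2 y| + `|dh1 y - dh2 y| + `|ddh1 y - ddh2 y| <=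
      C * (`|h1 0 - h2 0| + `|dh1 0 - dh2 0|).
Proof.
move=> K0; have [m m0 hm] := sol_lower_local K0.
have [C C0 hC] := @rhs_lipschitz K m sol_bound m0.
(* With u = |d| and v = |e|, |dE| <= 2 u v + 2 C (u + v) v, and 2 u v <= u^2 + v^2 yields the factor
   1 + 3 C. *)
pose G := 1 + 3 * C; have G0 : 0 <= G by rewrite /G; lra.
pose X := expR (G * K).
have X0 : 0 < X by exact: expR_gt0.
exists (2 * X + C * (2 * X)); first by rewrite addr_gt0 ?mulr_gt0.
move=> L1 h1 dh1 ddh1 L2 h2 dh2 ddh2 y KL1 KL2 s1 s2 yK.
have L10 : 0 < L1 by lra.
have L20 : 0 < L2 by lra.
have in1 t : - K <= t <= K -> - L1 < t < L1 by lra.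
have in2 t : - K <= t <= K -> - L2 < t < L2 by lra.
pose d : R -> R := fun t => h1 t - h2 t.
pose e : R -> R := fun t => dh1 t - dh2 t.
pose f : R -> R := fun t => ddh1 t - ddh2 t.
have dd t : - K <= t <= K -> is_derive t 1 d (e t).
  by move=> tK; apply: is_derive_subfun;
    [exact: (sol_derivable s1 (in1 t tK)).1|exact: (sol_derivable s2 (in2 t tK)).1].
have de t : - K <= t <= K -> is_derive t 1 e (f t).
  by move=> tK; apply: is_derive_subfun;
    [exact: (sol_derivable s1 (in1 t tK)).2|exact: (sol_derivable s2 (in2 t tK)).2].
have hb1 t : - K <= t <= K -> m <= h1 t <= sol_bound.
  move=> tK; apply/andP; split; first by apply: (hm L1 h1 dh1 ddh1) => //; lra.
  by apply: (sol_le L10 s1); have := in1 t tK; lra.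
have hb2 t : - K <= t <= K -> m <= h2 t <= sol_bound.
  move=> tK; apply/andP; split; first by apply: (hm L2 h2 dh2 ddh2) => //; lra.
  by apply: (sol_le L20 s2); have := in2 t tK; lra.
have fb t : - K <= t <= K -> `|f t| <= C * (`|d t| + `|e t|).
  move=> tK; rewrite /f (equation_rhs (sol_equation s1 (in1 t tK)))
    (equation_rhs (sol_equation s2 (in2 t tK))).
  by apply: hC => //; [exact: hb1|exact: hb2].
pose E : R -> R := fun t => d t * d t + e t * e t.
pose dE : R -> R := fun t => e t * d t + d t * e t + (f t * e t + e t * f t).
have EE t : E t = `|d t| ^+ 2 + `|e t| ^+ 2.
  by rewrite /E !real_normK ?num_real// !expr2.
have dEE t : - K <= t <= K -> is_derive t 1 E (dE t).
  by move=> tK; apply: is_derive_addfun; apply: is_derive_mulfun;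
    [exact: dd|exact: dd|exact: de|exact: de].
have dEb t : - K <= t <= K -> `|dE t| <= G * E t.
  move=> tK; rewrite EE /dE.
  have -> : e t * d t + d t * e t + (f t * e t + e t * f t) =
    2 * (d t * e t) + 2 * (f t * e t) by ring.
  apply: (le_trans (ler_normD _ _)); rewrite !normrM (@ger0_norm _ 2)//.
  have := fb t tK; have := normr_ge0 (d t); have := normr_ge0 (e t).
  have := normr_ge0 (f t).
  move: `|d t| `|e t| `|f t| => u v w w0 v0 u0 wuv.
  have q1 : w * v <= C * (u + v) * v by rewrite ler_wpM2r.
  have q2 : 0 <= (u - v) ^+ 2 by rewrite sqr_ge0.
  have q3 : 0 <= C * (u - v) ^+ 2 by rewrite mulr_ge0 ?sqr_ge0 ?ltW.
  have q4 : 0 <= C * u ^+ 2 by rewrite mulr_ge0 ?sqr_ge0 ?ltW.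
  by rewrite /G; lra.
set e0 := `|h1 0 - h2 0| + `|dh1 0 - dh2 0|.
have e00 : 0 <= e0 by rewrite addr_ge0.
have Ey : E y <= (e0 * X) ^+ 2.
  have q1 : E y * expR (- G * `|y|) <= E 0 := gronwall G0 dEE dEb yK.
  have q2 : E 0 <= e0 ^+ 2.
    rewrite EE /e0 sqrrD -/(d 0) -/(e 0) lerD2r lerDl.
    by rewrite mulrn_wge0// mulr_ge0.
  have q3 : E y = E y * expR (- G * `|y|) * expR (G * `|y|).
    by rewrite -mulrA -expRD mulNr addNr expR0 mulr1.
  have q4 : expR (G * `|y|) <= X.
    by rewrite ler_expR ler_wpM2l// ler_norml.
  have X1 : 1 <= X by rewrite -expR0 ler_expR mulr_ge0.
  have E0 : 0 <= E 0 by rewrite EE addr_ge0 ?sqr_ge0.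
  rewrite q3; apply: (@le_trans _ _ (E 0 * X)).
    by rewrite ler_pM ?expR_ge0// mulr_ge0 ?expR_ge0// EE addr_ge0 ?sqr_ge0.
  rewrite exprMn ler_pM ?(ltW X0)//.
  by rewrite expr2 ler_peMr ?(ltW X0).
have eX0 : 0 <= e0 * X by rewrite mulr_ge0 ?(ltW X0).
have dy : `|d y| <= e0 * X.
  rewrite -(ler_pXn2r (isT : (0 < 2)%N)) ?nnegrE//; apply: le_trans Ey.
  by rewrite EE lerDl sqr_ge0.
have ey : `|e y| <= e0 * X.
  rewrite -(ler_pXn2r (isT : (0 < 2)%N)) ?nnegrE//; apply: le_trans Ey.
  by rewrite EE lerDr sqr_ge0.
have fy : `|f y| <= C * (e0 * X + e0 * X).
  by apply: (le_trans (fb y yK)); rewrite ler_pM2l// lerD.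
rewrite -/(d y) -/(e y) -/(f y).
by move: dy ey fy; move: `|d y| `|e y| `|f y| => u v w *; lra.
Qed.

(* At a maximum of [w / h] with value [c] the equations give [c <= c `^ p],
   so [c <= 1] since [p < 1]. *)
Lemma subsolution_le L h dh ddh w dw ddw : 0 < L -> dirichlet_solution L h dh ddh ->
  (forall y, twice_derivable w dw ddw y) -> (forall y, 0 < w y) ->
  (forall y, 0 <= elliptic w dw ddw y + eta * w y `^ p) ->
  w (- L) <= h (- L) -> w L <= h L ->
  forall y, - L <= y <= L -> w y <= h y.
Proof.
move=> L0 hs wd w0 ws wl wr y yL.
have h0 t : - L <= t <= L -> 0 < h t by exact: (sol_gt0 hs).
have [||c cL hc] := @ratio_max _ w h (- L) L _ _ (sol_continuous hs) h0.
- lra.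
- by apply: continuous_itv => t _; exact: is_derive_continuous (wd t).1.
set r := w c / h c in hc.
have hc0 := h0 c cL; have wc0 := w0 c.
have r0 : 0 < r by exact: divr_gt0.
have whc : w c = r * h c by rewrite /r divfK// gt_eqF.
suff r1 : r <= 1.
  by apply: (le_trans (hc y yL)); rewrite ler_piMl// ltW// h0.
rewrite leNgt; apply/negP => r1.
have whlt : h c < w c by rewrite whc ltr_pMl.
have cNl : c != - L by apply: contraTneq whlt => ->; rewrite -leNgt.
have cNr : c != L by apply: contraTneq whlt => ->; rewrite -leNgt.
have cLo : - L < c < L.
  by have /andP[c1 c2] := cL; rewrite !lt_neqAle cNr eq_sym cNl c1.
have [|e1 e2] := touching_above cLo (fun t _ => wd t) (sol_derivable hs) _ whc.
  by move=> t tL; apply: hc; lra.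
have := sol_equation hs cLo; have := ws c; rewrite /elliptic e1 => q1 q2.
have A2 : A c / 2 * ddw c <= A c / 2 * (r * ddh c).
  by rewrite ler_wpM2l// divr_ge0// ltW.
have q3 : r * (A c / 2 * ddh c + b c * dh c - k c * h c + eta * h c `^ p) = 0.
  by rewrite q2 mulr0.
have q4 : w c `^ p = r `^ p * h c `^ p by rewrite whc powRM// ltW.
have rp : r `^ p < r.
  have q0 : 0 < 1 - p by rewrite subr_gt0.
  have : 1 < r `^ (1 - p).
    have := @gt0_ltr_powR _ _ q0 1 r.
    by rewrite !nnegrE ler01 (ltW r0) powR1; apply.
  by rewrite powR1B// ltr_pdivlMr ?mul1r// powR_gt0.
have q5 : 0 < eta * h c `^ p * (r - r `^ p).
  by rewrite mulr_gt0 ?subr_gt0// mulr_gt0 ?powR_gt0 ?eta_gt0.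
move: q1; rewrite q4 whc => q1.
by lra.
Qed.

Lemma exists_limit_solution (h dh ddh : R -> R -> R) :
  (forall L, 1 < L -> dirichlet_solution L (h L) (dh L) (ddh L)) ->
  exists (L_ : nat -> R) g dg ddg,
    [/\ (forall k, 1 < L_ k) /\ L_ n @[n --> \oo] --> +oo,
        [/\ cvg_loc_unif (fun n => h (L_ n)) g,
            cvg_loc_unif (fun n => dh (L_ n)) dg &
            cvg_loc_unif (fun n => ddh (L_ n)) ddg],
        forall y, twice_derivable g dg ddg y,
        forall y, 0 < g y &
        forall y, elliptic g dg ddg y + eta * g y `^ p = 0].
Proof.
move=> hs.
have [D D0 hD] := sol_derivative_local (lexx 0).
(* The shift by 3 makes every length exceed 2, the margin [sol_derivative_local] requires at the
   single point 0. *)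
have nL n : 0 + 2 < (n + 3)%:R :> R.
  by rewrite add0r ltr_nat addnC.
have nL1 n : 1 < (n + 3)%:R :> R by rewrite ltr1n addnC.
have z00 : - 0 <= (0 : R) <= 0 by rewrite oppr0 lexx.
have [n|n|f [a [b0 [fn ucv vcv]]]] := @bounded_subsequence2 _
    (fun n => h (n + 3)%:R 0) (fun n => dh (n + 3)%:R 0) (sol_bound + D).
- have hn := hs _ (nL1 n); have n0 : 0 < (n + 3)%:R :> R by rewrite ltr0n addnC.
  have zn : - (n + 3)%:R <= (0 : R) <= (n + 3)%:R by rewrite oppr_le0 !ler0n.
  rewrite ger0_norm ?(sol_ge0 hn zn)//.
  by have := sol_le n0 hn zn; lra.
- have := hD _ _ _ _ 0 (nL n) (hs _ (nL1 n)) z00.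
  have : 0 <= sol_bound by rewrite /sol_bound le_max invr_ge0 (ltW kl_gt0).
  by move=> ? ?; lra.
pose L_ n : R := (f n + 3)%:R.
have L1 n : 1 < L_ n by exact: nL1.
have Lbig (B : R) : exists N, forall n, (N <= n)%N -> B < L_ n.
  exists (Num.bound B) => n Bn; apply: (le_lt_trans (ler_norm B)).
  apply: (lt_le_trans (archi_boundP (normr_ge0 B))).
  have -> : Num.bound `|B| = Num.bound B by rewrite /Num.bound normr_id.
  by rewrite ler_nat (leq_trans Bn)// (leq_trans (fn n))// leq_addr.
have stab (K e : R) : 0 < e -> exists N, forall i j, (N <= i)%N -> (N <= j)%N ->
    forall y, - K <= y <= K ->
    `|h (L_ i) y - h (L_ j) y| + `|dh (L_ i) y - dh (L_ j) y| +
      `|ddh (L_ i) y - ddh (L_ j) y| <= e.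
  move=> e0; have [Kn|Kp] := ltP K 0; first by exists 0 => i j _ _ y ?; lra.
  have [C C0 hC] := sol_stability Kp.
  (* Each of the four numbers h(0), h'(0) at indices [i] and [j] is this close to its limit, so the
     data differ by at most e / C in total. *)
  have d0 : 0 < e / (4 * C) by rewrite divr_gt0 ?mulr_gt0.
  have dC : C * (e / (4 * C)) = e / 4 by field; rewrite gt_eqF.
  have [N1 h1] := (cvgn_epsP _ _).1 ucv _ d0.
  have [N2 h2] := (cvgn_epsP _ _).1 vcv _ d0.
  have [N3 h3] := Lbig (K + 2).
  exists (maxn (maxn N1 N2) N3) => i j.
  rewrite !geq_max => /andP[/andP[i1 i2] i3] /andP[/andP[j1 j2] j3] y yK.
  apply: (le_trans (hC _ _ _ _ _ _ _ _ y (h3 i i3) (h3 j j3)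
    (hs _ (L1 i)) (hs _ (L1 j)) yK)).
  have q1 := h1 i i1; have q2 := h1 j j1; have q3 := h2 i i2; have q4 := h2 j j2.
  have := ler_normB (h (L_ i) 0 - a) (h (L_ j) 0 - a).
  have := ler_normB (dh (L_ i) 0 - b0) (dh (L_ j) 0 - b0).
  rewrite [X in `|X|](_ : _ = dh (L_ i) 0 - dh (L_ j) 0); last ring.
  rewrite [X in _ -> `|X| <= _ -> _](_ : _ = h (L_ i) 0 - h (L_ j) 0); last ring.
  move=> q5 q6; rewrite /= in q1 q2 q3 q4.
  have {}q6 : `|h (L_ i) 0 - h (L_ j) 0| + `|dh (L_ i) 0 - dh (L_ j) 0|
      <= 4 * (e / (4 * C)).
    by move: q1 q2 q3 q4 q5 q6; rewrite -/(L_ i) -/(L_ j); lra.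
  by apply: (le_trans (ler_wpM2l (ltW C0) q6)); lra.
have [|g hg] := @cauchy_cvg_loc_unif _ (fun n => h (L_ n)).
  move=> K e /(stab K)[N hN]; exists N => i j Ni Nj y yK.
  by apply: le_trans (hN i j Ni Nj y yK); rewrite -addrA lerDl addr_ge0.
have [|dg hdg] := @cauchy_cvg_loc_unif _ (fun n => dh (L_ n)).
  move=> K e /(stab K)[N hN]; exists N => i j Ni Nj y yK.
  by apply: le_trans (hN i j Ni Nj y yK); rewrite addrAC lerDr addr_ge0.
have [|ddg hddg] := @cauchy_cvg_loc_unif _ (fun n => ddh (L_ n)).
  move=> K e /(stab K)[N hN]; exists N => i j Ni Nj y yK.
  by apply: le_trans (hN i j Ni Nj y yK); rewrite lerDr addr_ge0.
have solL (K : R) : exists N, forall j, (N <= j)%N -> forall y, - K <= y <= K ->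
    - L_ j < y < L_ j.
  by have [N hN] := Lbig K; exists N => j /hN Kj y yK; lra.
have gd (y : R) : is_derive y 1 g (dg y).
  apply: cvg_loc_unif_derive hg hdg y => K; have [N hN] := solL K.
  exists N => j Nj y yK; have yj := hN j Nj y yK.
  have [d1 d2] := sol_derivable (hs _ (L1 j)) yj.
  by split => //; exact: is_derive_continuous d2.
have dgd (y : R) : is_derive y 1 dg (ddg y).
  apply: cvg_loc_unif_derive hdg hddg y => K; have [N hN] := solL K.
  exists N => j Nj y yK; have yj := hN j Nj y yK.
  have [d1 d2] := sol_derivable (hs _ (L1 j)) yj.
  by split => //; exact: (sol_derive2_continuous (hs _ (L1 j))).
have yy (y : R) : - `|y| <= y <= `|y| by rewrite -ler_norml.
(* Positivity could be lost in the limit; the bound [m] is independent of the index and survives up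
   to m / 2. *)
have g0 y : 0 < g y.
  have [m m0 hm] := sol_lower_local (normr_ge0 y).
  have m2 : 0 < m / 2 by lra.
  have [N1 h1] := hg `|y| (m / 2) m2; have [N2 h2] := Lbig (`|y| + 1).
  have := h1 (maxn N1 N2) (leq_maxl _ _) y (yy y).
  have := hm _ _ _ _ y (h2 (maxn N1 N2) (leq_maxr _ _)) (hs _ (L1 _)) (yy y).
  by rewrite ler_norml => ? ?; lra.
exists L_, g, dg, ddg; split => //.
- split => //; apply/cvgryPge => B; have [N hN] := Lbig B.
  by exists N => // n /hN/ltW.
- move=> y.
  have c1 := @cvg_loc_unif_pointwise _ _ _ y hg.
  have c2 := @cvg_loc_unif_pointwise _ _ _ y hdg.
  have c3 := @cvg_loc_unif_pointwise _ _ _ y hddg.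
  (* Positivity of the limit gives continuity of the power at [g y]. *)
  have c4 := cvg_comp _ _ c1 (@powR_continuous _ p _ (g0 y)).
  have c5 : (fun n => elliptic (h (L_ n)) (dh (L_ n)) (ddh (L_ n)) y +
      eta * h (L_ n) y `^ p) @ \oo --> elliptic g dg ddg y + eta * g y `^ p.
    exact: cvgD (cvgB (cvgD (cvgMl_tmp c3) (cvgMl_tmp c2)) (cvgMl_tmp c1))
      (cvgMl_tmp c4).
  apply: (norm_cvg_unique c5); apply: cvg_near_cst.
  have [N hN] := solL `|y|; exists N => // j /= Nj.
  exact: (sol_equation (hs _ (L1 j)) (hN j Nj y (yy y))).
Qed.

End semilinear_equation.

(** * Locally Lipschitz functions *)

Section local_regularity.
Context {R : realType}.
Implicit Types (f g df : R -> R) (alpha x y K C : R).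

(** An intermediate class: it contains the coefficients, is stable under sums, products, inverses of
    nonvanishing functions and powers of positive ones, and lies in every local Hölder class of
    exponent in (0, 1]. *)
Definition loc_lipschitz f := forall K, exists C, forall x y,
  - K <= x <= K -> - K <= y <= K -> `|f x - f y| <= C * `|x - y|.

Lemma loc_lipschitz_continuous f : loc_lipschitz f -> continuous f.
Proof.
move=> fl x; apply/continuous_epsP => e e0; have [C fC] := fl (`|x| + 1).
have C0 : 0 < `|C| + 1 by rewrite ltr_wpDl.
exists (Num.min 1 (e / (`|C| + 1))) => [|y].
  by rewrite lt_min ltr01 divr_gt0.
rewrite lt_min => /andP[yx1 yxe].
have xK : - (`|x| + 1) <= x <= `|x| + 1 by rewrite -ler_norml lerDl.
have yK : - (`|x| + 1) <= y <= `|x| + 1.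
  rewrite -ler_norml; have := ler_normD (y - x) x.
  by rewrite subrK => ?; lra.
apply: (le_lt_trans (fC y x yK xK)); move: yxe; rewrite ltr_pdivlMr//.
have := ler_norm C; have := normr_ge0 (y - x) => n0 nC.
by have := ler_wpM2r n0 nC; lra.
Qed.

Lemma continuous_bounded_sym f K : continuous f ->
  exists2 C : R, 0 < C & forall y, - K <= y <= K -> `|f y| <= C.
Proof. by move=> cf; apply: continuous_bounded_itv => x _; exact: cf. Qed.

Lemma loc_lipschitz_cst (c : R) : loc_lipschitz (fun=> c).
Proof. by move=> K; exists 0 => x y _ _; rewrite subrr normr0 mul0r. Qed.

Lemma loc_lipschitzD f g : loc_lipschitz f -> loc_lipschitz g ->
  loc_lipschitz (fun y => f y + g y).
Proof.
move=> fl gl K; have [C fC] := fl K; have [D gD] := gl K.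
exists (C + D) => x y xK yK.
have -> : f x + g x - (f y + g y) = (f x - f y) + (g x - g y) by ring.
by rewrite mulrDl (le_trans (ler_normD _ _))// lerD ?fC ?gD.
Qed.

Lemma loc_lipschitzM f g : loc_lipschitz f -> loc_lipschitz g ->
  loc_lipschitz (fun y => f y * g y).
Proof.
move=> fl gl K; have [C fC] := fl K; have [D gD] := gl K.
have [B B0 fB] := continuous_bounded_sym K (loc_lipschitz_continuous fl).
have [B' B'0 gB] := continuous_bounded_sym K (loc_lipschitz_continuous gl).
exists (B * D + C * B') => x y xK yK.
have -> : f x * g x - f y * g y = f x * (g x - g y) + (f x - f y) * g y by ring.
rewrite (le_trans (ler_normD _ _))// !normrM mulrDl; apply: lerD.
  by rewrite -mulrA ler_pM// ?fB ?gD.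
by rewrite mulrAC ler_pM// ?fC ?gB.
Qed.

Lemma loc_lipschitzN f : loc_lipschitz f -> loc_lipschitz (fun y => - f y).
Proof.
move=> fl K; have [C fC] := fl K; exists C => x y xK yK.
by rewrite -opprD normrN fC.
Qed.

Lemma loc_lipschitzV f : (forall y, f y != 0) -> loc_lipschitz f ->
  loc_lipschitz (fun y => (f y)^-1).
Proof.
move=> f0 fl K; have [C fC] := fl K.
have fc := loc_lipschitz_continuous fl.
have [x _|x _|c c0 fc0] := @continuous_gt0_itv _ (fun x => `|f x|) (- K) K.
- by apply: (@continuous_comp _ _ _ f); [exact: fc|exact: norm_continuous].
- by rewrite normr_gt0.
exists (C / c ^+ 2) => x y xK yK.
have -> : (f x)^-1 - (f y)^-1 = (f y - f x) / (f x * f y).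
  by field; rewrite !f0.
rewrite normrM distrC normfV normrM mulrAC ler_pM ?invr_ge0//.
  by rewrite fC.
rewrite lef_pV2 ?posrE ?mulr_gt0 ?normr_gt0 ?f0//.
by rewrite ler_pM ?fc0 ?(ltW c0).
Qed.

Lemma loc_lipschitz_sum (I : Type) (r : seq I) (P : pred I) (F : I -> R -> R) :
  (forall i, loc_lipschitz (F i)) ->
  loc_lipschitz (fun y => \sum_(i <- r | P i) F i y).
Proof.
move=> Fl; elim: r => [|i r IH].
  by under eq_fun do rewrite big_nil; exact: loc_lipschitz_cst.
under eq_fun do rewrite big_cons; case: (P i) => //; exact: loc_lipschitzD.
Qed.

Lemma loc_lipschitz_prod (I : Type) (r : seq I) (P : pred I) (F : I -> R -> R) :
  (forall i, loc_lipschitz (F i)) ->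
  loc_lipschitz (fun y => \prod_(i <- r | P i) F i y).
Proof.
move=> Fl; elim: r => [|i r IH].
  by under eq_fun do rewrite big_nil; exact: loc_lipschitz_cst.
under eq_fun do rewrite big_cons; case: (P i) => //; exact: loc_lipschitzM.
Qed.

Lemma loc_lipschitz_powR f (p : R) : (forall y, 0 < f y) -> loc_lipschitz f ->
  loc_lipschitz (fun y => f y `^ p).
Proof.
move=> f0 fl K; have [C fC] := fl K.
have fc := loc_lipschitz_continuous fl.
have [x _|x _|c c0 fc0] := @continuous_gt0_itv _ f (- K) K.
- exact: fc.
- exact: f0.
have [B B0 fB] := continuous_bounded_sym K fc.
have [D D0 hD] := @powR_lipschitz _ p c B c0.
have fcB y : - K <= y <= K -> c <= f y <= B.
  by move=> yK; rewrite fc0//= (le_trans (ler_norm _))// fB.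
exists (D * C) => x y xK yK; apply: (le_trans (hD _ _ (fcB x xK) (fcB y yK))).
by rewrite -mulrA ler_pM2l// fC.
Qed.

Lemma loc_lipschitz_derive f df : (forall y, is_derive y 1 f (df y)) ->
  (forall K, exists C, forall y, - K <= y <= K -> `|df y| <= C) -> loc_lipschitz f.
Proof.
move=> fd dfb K; have [C dfC] := dfb K; exists C => x y xK yK.
exact: (derive_lipschitz (fun t _ => fd t) dfC).
Qed.

(** Split |x - y| into its powers 1 - alpha and alpha; the first is at most (2 K)^(1 - alpha) in the
    window. *)
Lemma loc_lipschitz_holder alpha f : 0 < alpha <= 1 -> loc_lipschitz f ->
  loc_holder alpha f.
Proof.
move=> /andP[a0 a1] fl A /compact_bounded[M [_ AM]].
pose K := `|M| + 1.
have AK y : A y -> - K <= y <= K.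
  move=> Ay; rewrite -ler_norml; apply: (AM K) => //.
  by rewrite /K (le_lt_trans (ler_norm M))// ltrDl.
have [C fC] := fl K; exists (`|C| * (2 * K) `^ (1 - alpha)) => x y Ax Ay.
apply: (le_trans (fC x y (AK x Ax) (AK y Ay))).
have [->|xy] := eqVneq x y.
  by rewrite subrr normr0 mulr0 mulr_ge0 ?mulr_ge0 ?powR_ge0.
have xy0 : 0 < `|x - y| by rewrite normr_gt0 subr_eq0.
have -> : C * `|x - y| = C * `|x - y| `^ (1 - alpha) * `|x - y| `^ alpha.
  by rewrite -mulrA powR1B// divfK// gt_eqF// powR_gt0.
rewrite ler_wpM2r ?powR_ge0//.
apply: (@le_trans _ _ (`|C| * `|x - y| `^ (1 - alpha))).
  by rewrite ler_wpM2r ?powR_ge0 ?ler_norm.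
rewrite ler_wpM2l// ge0_ler_powR ?nnegrE//; first by rewrite subr_ge0.
  by rewrite mulr_ge0// /K addr_ge0.
have := AK x Ax; have := AK y Ay; rewrite ler_norml => ? ?; lra.
Qed.

(** Comparison with the value at 0. Applied to the derivative of a C^(1,alpha) function, it makes
    that function locally Lipschitz. *)
Lemma loc_holder_bounded alpha f K : 0 < alpha -> loc_holder alpha f ->
  exists C, forall y, - K <= y <= K -> `|f y| <= C.
Proof.
move=> a0 fh; have [K0|K0] := ltP K 0; first by exists 0 => y ?; lra.
have [C fC] := fh `[- K, K]%classic (@segment_compact _ _ _).
exists (`|f 0| + `|C| * K `^ alpha) => y yK.
have yK' : `[- K, K]%classic y by rewrite /= in_itv.
have zK' : `[- K, K]%classic (0 : R) by rewrite /= in_itv/= oppr_le0 K0.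
have := fC y 0 yK' zK'; rewrite subr0 => q1.
have q2 : `|y| `^ alpha <= K `^ alpha.
  by rewrite ge0_ler_powR ?nnegrE ?(ltW a0)// ler_norml.
have q3 : C * `|y| `^ alpha <= `|C| * K `^ alpha.
  apply: (@le_trans _ _ (`|C| * `|y| `^ alpha)).
    by rewrite ler_wpM2r ?powR_ge0 ?ler_norm.
  by rewrite ler_wpM2l.
have := ler_normD (f y - f 0) (f 0); rewrite subrK => ?; lra.
Qed.

Lemma derivable_is_derive f x : derivable f x 1 -> is_derive x 1 f (f^`()%classic x).
Proof. by move=> fx; rewrite derive1E; exact: derivableP. Qed.

Lemma Ckholder1_loc_lipschitz alpha f : 0 < alpha -> Ckholder 1 alpha f ->
  loc_lipschitz f.
Proof.
move=> a0 [fd fh]; apply: (@loc_lipschitz_derive _ f^`()%classic) => [y|K].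
  by apply: derivable_is_derive; exact: (fd 0%N).
exact: loc_holder_bounded a0 fh.
Qed.

Lemma Ckholder2_loc_lipschitz alpha f : Ckholder 2 alpha f -> loc_lipschitz f.
Proof.
move=> [fd _]; apply: (@loc_lipschitz_derive _ f^`()%classic) => [y|K].
  by apply: derivable_is_derive; exact: (fd 0%N).
have [|C C0 hC] := @continuous_bounded_sym f^`()%classic K; last by exists C.
by move=> y; apply: is_derive_continuous (derivable_is_derive (fd 1%N isT y)).
Qed.

End local_regularity.

(** * Matrix-valued coefficients *)

Section matrix_regularity.
Context {R : realType}.
Implicit Types (m n p : nat).

Definition loc_lipschitz_mx m n (F : R -> 'M[R]_(m, n)) :=
  forall i j, loc_lipschitz (fun y => F y i j).

Lemma loc_lipschitz_mulmx m n p (F : R -> 'M[R]_(m, n)) (G : R -> 'M[R]_(n, p)) :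
  loc_lipschitz_mx F -> loc_lipschitz_mx G ->
  loc_lipschitz_mx (fun y => F y *m G y).
Proof.
move=> Fl Gl i j; under eq_fun do rewrite mxE.
by apply: loc_lipschitz_sum => k; exact: loc_lipschitzM.
Qed.

Lemma loc_lipschitz_tr m n (F : R -> 'M[R]_(m, n)) :
  loc_lipschitz_mx F -> loc_lipschitz_mx (fun y => (F y)^T).
Proof. by move=> Fl i j; under eq_fun do rewrite mxE; exact: Fl. Qed.

Lemma loc_lipschitz_det n (F : R -> 'M[R]_n) :
  loc_lipschitz_mx F -> loc_lipschitz (fun y => \det (F y)).
Proof.
move=> Fl; apply: loc_lipschitz_sum => s.
apply: loc_lipschitzM; first exact: loc_lipschitz_cst.
by apply: loc_lipschitz_prod => i; exact: Fl.
Qed.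

(** Cramer's rule: each entry is a cofactor divided by a nonvanishing determinant. *)
Lemma loc_lipschitz_invmx n (F : R -> 'M[R]_n) : (forall y, F y \in unitmx) ->
  loc_lipschitz_mx F -> loc_lipschitz_mx (fun y => invmx (F y)).
Proof.
move=> Fu Fl i j; under eq_fun do rewrite /invmx Fu !mxE.
apply: loc_lipschitzM.
  apply: loc_lipschitzV; last exact: loc_lipschitz_det.
  by move=> y; have := Fu y; rewrite unitmxE unitfE.
apply: loc_lipschitzM; first exact: loc_lipschitz_cst.
apply: loc_lipschitz_det => k l.
by under eq_fun do rewrite !mxE; exact: Fl.
Qed.

Lemma posdef_unitmx n (S : 'M[R]_n) :
  (forall v : 'cV[R]_n, v != 0 -> 0 < (v^T *m S *m v) 0 0) -> S \in unitmx.
Proof.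
move=> Spos; rewrite unitmxE unitfE; apply/negP => /det0P[v v0 vS].
have := Spos v^T; rewrite trmxK vS mul0mx mxE ltxx.
by rewrite trmx_eq0 => /(_ v0).
Qed.

End matrix_regularity.

(** * Derivatives of the weight [phi_fun] *)

Section derivatives.
Context {R : realType}.
Implicit Types (f df ddf : R -> R).

Lemma derive1_fun f df : (forall y : R, is_derive y 1 f (df y)) ->
  f^`()%classic = df.
Proof. by move=> fd; apply/funext => y; rewrite derive1E; exact: derive_val. Qed.

Lemma derive2_fun f df ddf : (forall y, twice_derivable f df ddf y) ->
  f^`()%classic = df /\ f^`(2)%classic = ddf.
Proof.
move=> fd; have e1 : f^`()%classic = df by apply: derive1_fun => y; exact: (fd y).1.
have e2 : df^`()%classic = ddf by apply: derive1_fun => y; exact: (fd y).2.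
by split=> //; rewrite -e2 -e1.
Qed.

(** Stated with the derivatives that [linear_part] evaluates, so that [admissible_C1] applies as it
    stands. *)
Lemma twice_derivable_phi (ad y : R) :
  twice_derivable (phi_fun ad) (phi_fun ad)^`()%classic (phi_fun ad)^`(2)%classic y.
Proof.
pose s : R -> R := fun t => 1 + t ^+ 2.
have s0 t : 0 < s t by rewrite ltr_wpDr// sqr_ge0.
have sd (t : R) : is_derive t 1 s (2 * t).
  have := is_derive_addfun (is_derive_cst (1 : R) t 1)
    (is_derive_mulfun (is_derive_id t 1) (is_derive_id t 1)).
  by congr is_derive; rewrite /=; ring.
have pd (q t : R) : is_derive t 1 (fun t => s t `^ q) (q * s t `^ (q - 1) * (2 * t)).
  exact: is_derive1_comp (is_derive1_powR q (s0 t)) (sd t).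
pose q := - ad / 2.
pose d1 : R -> R := fun t => q * s t `^ (q - 1) * (2 * t).
pose d2 : R -> R := fun t => q * ((q - 1) * s t `^ (q - 1 - 1) * (2 * t)) * (2 * t) +
  q * s t `^ (q - 1) * (2 * 1).
have td t : twice_derivable (phi_fun ad) d1 d2 t.
  split; first exact: pd.
  exact: is_derive_mulfun (is_derive_scalefun q (pd (q - 1) t))
    (is_derive_scalefun 2 (is_derive_id t 1)).
by have [-> ->] := derive2_fun td.
Qed.

End derivatives.

(** * The market coefficients satisfy the hypotheses of the equation *)

Section market_coefficients.
Context {R : realType} (n : nat) (alpha : R) (m : market R n) (q : preferences R).
Hypotheses (alpha01 : 0 < alpha < 1) (hm : market_assumptions m alpha)
  (hq : preference_assumptions q).

Let a0 : 0 < alpha. Proof. by case/andP: alpha01. Qed.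

Lemma a2_loc_lipschitz : loc_lipschitz (fun y => mkt_a m y ^+ 2).
Proof. by case: hm => _ [_ [_ [[h _ _] _]]]; exact: Ckholder2_loc_lipschitz h. Qed.

Let mu_loc_lipschitz : loc_lipschitz_mx (mkt_mu m).
Proof.
move=> i j; rewrite (ord1 j); case: hm => -[_ _ h] _.
exact: Ckholder1_loc_lipschitz a0 (h i).
Qed.

Let Upsilon_loc_lipschitz : loc_lipschitz_mx (Upsilon m).
Proof.
move=> i j; rewrite (ord1 j); case: hm => _ [_ [_ [[_ _ h] _]]].
exact: Ckholder2_loc_lipschitz (h i).
Qed.

Let invSigma_loc_lipschitz : loc_lipschitz_mx (fun y => invmx (Sigma m y)).
Proof.
case: hm => _ [_ [_ [[_ h _] [pos _]]]]; apply: loc_lipschitz_invmx.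
  by move=> y; apply: posdef_unitmx; exact: pos.
by move=> i j; exact: Ckholder2_loc_lipschitz (h i j).
Qed.

Lemma b_tilde_loc_lipschitz : loc_lipschitz (b_tilde m q).
Proof.
apply: loc_lipschitzD.
  by case: hm => -[_ h _] _; exact: Ckholder1_loc_lipschitz a0 h.
apply: loc_lipschitzN; apply: loc_lipschitzM; first exact: loc_lipschitz_cst.
apply: loc_lipschitz_mulmx => //; apply: loc_lipschitz_mulmx => //.
exact: loc_lipschitz_tr.
Qed.

Lemma kappa_loc_lipschitz : loc_lipschitz (kappa_fun m q).
Proof.
apply: loc_lipschitzM; first exact: loc_lipschitz_cst.
apply: loc_lipschitzD; first exact: loc_lipschitz_cst.
apply: loc_lipschitzM; first exact: loc_lipschitz_cst.
apply: loc_lipschitzD.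
  by case: hm => -[h _ _] _; exact: Ckholder1_loc_lipschitz a0 h.
apply: loc_lipschitzM; first exact: loc_lipschitz_cst.
apply: loc_lipschitz_mulmx => //; apply: loc_lipschitz_mulmx => //.
exact: loc_lipschitz_tr.
Qed.

Lemma chi_gt0 : 0 < chi m q.
Proof.
case: hq => _ _ [g0 _] _; case: hm => _ [_ [rho1 _]].
set s := ((mkt_rho m)^T *m mkt_rho m) 0 0 in rho1 *.
have s0 : 0 <= s.
  by rewrite /s mxE sumr_ge0// => i _; rewrite mxE -expr2 sqr_ge0.
have s1 : s <= 1 by rewrite -[s]sqr_sqrtr// expr_le1 ?sqrtr_ge0.
rewrite /chi -/s divr_gt0//.
(* Since s = |rho|^2 lies in [0, 1], the denominator is a convex combination of gamma and 1. *)
have -> : prf_gamma q + (1 - prf_gamma q) * s = prf_gamma q * (1 - s) + s by ring.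
have [->|sN0] := eqVneq s 0; first by rewrite subr0 mulr1 addr0.
by rewrite ltr_wpDl ?mulr_ge0 ?subr_ge0 ?(ltW g0)// lt_neqAle eq_sym sN0.
Qed.

(** The quotient equals psi / vartheta. Its sign is the common source of p < 1 and eta > 0. *)
Let ratio_gt0 : 0 < (prf_psi q - 1) / (1 - prf_gamma q).
Proof.
case: hq => _ [psi0 psi1] [g0 g1]; rewrite /vartheta => th0.
have psi1' : prf_psi q - 1 != 0 by rewrite subr_eq0.
have g1' : 1 - prf_gamma q != 0 by rewrite subr_eq0 eq_sym.
have -> : (prf_psi q - 1) / (1 - prf_gamma q) =
    prf_psi q / ((1 - prf_gamma q) / (1 - (prf_psi q)^-1)).
  rewrite (_ : 1 - (prf_psi q)^-1 = (prf_psi q - 1) / prf_psi q).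
    by field; rewrite g1' psi1' gt_eqF.
  by field; rewrite gt_eqF.
by rewrite divr_gt0.
Qed.

Lemma pexp_lt1 : pexp m q < 1.
Proof. by rewrite /pexp gtrBl -mulrA; exact: mulr_gt0 chi_gt0 ratio_gt0. Qed.

Lemma eta_cst_gt0 : 0 < eta_cst m q.
Proof.
have -> : eta_cst m q =
    prf_beta q `^ prf_psi q / (chi m q * ((prf_psi q - 1) / (1 - prf_gamma q))).
  rewrite /eta_cst; move: (chi m q) => c; rewrite !invfM invrK.
  by move: c^-1 (prf_psi q - 1)^-1 => c' d; ring.
case: hq => beta0 _ _ _; apply: divr_gt0; first exact: powR_gt0.
exact: mulr_gt0 chi_gt0 ratio_gt0.
Qed.

Lemma regular_market_coefficients (kl : R) : 0 < kl ->
  (forall y, kl <= kappa_fun m q y) ->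
  regular_coefficients (fun y => mkt_a m y ^+ 2) (b_tilde m q) (kappa_fun m q)
    (eta_cst m q) (pexp m q) kl.
Proof.
move=> kl0 hkl; split => //.
- by case: hm => _ [_ [_ [_ [_ [h _]]]]]; exact: h.
- exact: loc_lipschitz_continuous a2_loc_lipschitz.
- exact: loc_lipschitz_continuous b_tilde_loc_lipschitz.
- exact: loc_lipschitz_continuous kappa_loc_lipschitz.
- exact: eta_cst_gt0.
- exact: pexp_lt1.
Qed.

End market_coefficients.

(** * The global lower barrier [c0 * phi] *)

Section barrier.
Context {R : realType} (n : nat) (m : market R n) (q : preferences R).
Implicit Types (y L kl : R).

Local Notation sol := (dirichlet_solution (fun y => mkt_a m y ^+ 2) (b_tilde m q)
  (kappa_fun m q) (eta_cst m q) (pexp m q)).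
Local Notation ell := (elliptic (fun y => mkt_a m y ^+ 2) (b_tilde m q)
  (kappa_fun m q)).

Lemma classical_dirichlet_solution L (h : R -> R) : classical_solution m q L h ->
  sol L h h^`()%classic h^`(2)%classic.
Proof.
move=> [hd hc [h0 h0'] heq [hl hr]].
apply: DirichletSolution; last exact: hr; last exact: hl.
- move=> y yL; have [|d1 d2 _] := hd y; first by rewrite /= in_itv.
  by split; exact: derivable_is_derive.
- by move=> y yL; have [|_ _] := hd y; first by rewrite /= in_itv.
- exact: hc.
- by move=> y yL; apply: h0; rewrite ?inE/= in_itv.
- by move=> p0 y yL; apply: h0' => //; rewrite ?inE/= in_itv.
- by move=> y yL; apply: heq; rewrite ?inE/= in_itv.
Qed.

(** Shows that the supremum in [c0_cst] is taken over a bounded set and hence dominates each weight.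
    Both 1 and s^u are at most (1 + s^2)^(v/2), whence the 2. *)
Lemma sup_weight_ub (u v s : R) : 0 < u -> u < v -> 0 <= s ->
  (1 + s ^+ 2) `^ (- v / 2) * (1 + s `^ u) <= 2.
Proof.
move=> u0 uv s0; have v0 : 0 < v by exact: lt_trans uv.
have s2 : 1 <= 1 + s ^+ 2 by rewrite lerDl sqr_ge0.
have P1 : 1 <= (1 + s ^+ 2) `^ (v / 2).
  by rewrite -[leLHS](powRr0 (1 + s ^+ 2)) ler_powR// divr_ge0// ltW.
have sP : s `^ u <= (1 + s ^+ 2) `^ (v / 2).
  have [s1|s1] := leP s 1.
    apply: le_trans P1; have := @ge0_ler_powR R u (ltW u0) s 1.
    by rewrite !nnegrE s0 ler01 powR1; apply.
  apply: (@le_trans _ _ (s `^ v)); first by rewrite ler_powR// ltW.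
  have -> : s `^ v = (s ^+ 2) `^ (v / 2).
    by rewrite -powR_mulrn// -powRrM mulrC divfK.
  by rewrite ge0_ler_powR ?nnegrE ?sqr_ge0 ?divr_ge0 ?(ltW v0)// ?lerDr//; lra.
have -> : - v / 2 = - (v / 2) by rewrite mulNr.
rewrite powRN mulrC ler_pdivrMr; first by lra.
exact: lt_le_trans P1.
Qed.

Section c0_barrier.
Variables (kl C_s alpha_s alpha_d C1 c1 : R).
Hypotheses (C_s0 : 0 < C_s) (alpha_s0 : 0 < alpha_s).
Hypothesis coef : regular_coefficients (fun y => mkt_a m y ^+ 2) (b_tilde m q)
  (kappa_fun m q) (eta_cst m q) (pexp m q) kl.
Hypothesis growth : forall y, `|mkt_a m y| + `|b_tilde m q y| + kappa_fun m q y
         <= C_s * (1 + `|y| `^ alpha_s).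
Hypothesis alpha_sd : alpha_s < alpha_d.
Hypotheses (hC1 : admissible_C1 m q alpha_s alpha_d C1)
  (hc1 : admissible_c1 m q alpha_s alpha_d c1).

Local Notation c0 := (c0_cst m q C_s alpha_s alpha_d C1 c1).
Local Notation phi := (phi_fun alpha_d).
Local Notation eta := (eta_cst m q).
Local Notation p := (pexp m q).
Let weights := [set (1 + s ^+ 2) `^ (- alpha_d / 2) * (1 + s `^ alpha_s)
  | s in [set s : R | 0 <= s]].

Let weight_le (s : R) : 0 <= s ->
  (1 + s ^+ 2) `^ (- alpha_d / 2) * (1 + s `^ alpha_s) <= sup weights.
Proof.
move=> s0; apply: ub_le_sup; last by exists s.
by exists 2 => _ [t /= t0 <-]; exact: sup_weight_ub.
Qed.

Let sup_weights_gt0 : 0 < sup weights.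
Proof.
apply: lt_le_trans (weight_le (lexx 0)).
by rewrite expr0n/= addr0 powR1 mul1r powR0 ?gt_eqF// addr0.
Qed.

Let phi_gt0 y : 0 < phi y.
Proof. by rewrite powR_gt0// ltr_wpDr// sqr_ge0. Qed.

Let X_gt0 : 0 < eta * c1 / C1.
Proof. exact: divr_gt0 (mulr_gt0 (coef_eta_gt0 coef) hc1.1) hC1.1. Qed.

Let c0_gt0 : 0 < c0.
Proof.
rewrite /c0_cst !lt_min ltr01/= powR_gt0//=.
by rewrite invr_gt0 mulr_gt0.
Qed.

(** The third entry of the minimum defining c0 is made for the endpoints: the growth bound gives phi
    kappa <= C_s sup. *)
Let phi_boundary y : c0 * phi y <= (kappa_fun m q y)^-1.
Proof.
have k0 : 0 < kappa_fun m q y.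
  by exact: lt_le_trans (coef_kl_gt0 coef) (coef_k_ge coef y).
rewrite -[leRHS]mul1r ler_pdivlMr//.
have c0Y : c0 <= (C_s * sup weights)^-1.
  by rewrite /c0_cst ge_min ge_min lexx !orbT.
have ky : kappa_fun m q y <= C_s * (1 + `|y| `^ alpha_s).
  have := growth y; have := normr_ge0 (mkt_a m y).
  by have := normr_ge0 (b_tilde m q y); lra.
have := weight_le (normr_ge0 y); rewrite real_normK ?num_real// => wy.
rewrite -mulrA.
have phik : phi y * kappa_fun m q y <= C_s * sup weights.
  apply: (@le_trans _ _ (phi y * (C_s * (1 + `|y| `^ alpha_s)))).
    by rewrite ler_pM2l.
  by rewrite mulrCA ler_pM2l.
apply: (@le_trans _ _ ((C_s * sup weights)^-1 * (C_s * sup weights))).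
  by rewrite ler_pM ?(ltW c0_gt0)// mulr_ge0 ?(ltW k0) ?(ltW (phi_gt0 y)).
by rewrite mulVf// gt_eqF// mulr_gt0.
Qed.

(** The second entry of the minimum: as p - 1 < 0, a small c0 makes the power term dominate the
    linear part. *)
Let c0_pow : C1 <= eta * c1 * c0 `^ (p - 1).
Proof.
have q0 : 0 < 1 - p by rewrite subr_gt0 (coef_p_lt1 coef).
have c0X : c0 <= (eta * c1 / C1) `^ (1 - p)^-1.
  by rewrite /c0_cst ge_min ge_min lexx orbT.
have : c0 `^ (1 - p) <= eta * c1 / C1.
  have -> : eta * c1 / C1 = ((eta * c1 / C1) `^ (1 - p)^-1) `^ (1 - p).
    by rewrite -powRrM mulVf ?gt_eqF// powRr1 ?(ltW X_gt0).
  by rewrite ge0_ler_powR ?nnegrE ?powR_ge0 ?(ltW c0_gt0) ?(ltW q0).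
have -> : c0 `^ (p - 1) = (c0 `^ (1 - p))^-1 by rewrite -powRN opprB.
rewrite ler_pdivlMr ?hC1.1// => c0X'.
by rewrite ler_pdivlMr ?powR_gt0// mulrC.
Qed.

(** With c0 phi (1 + |y|)^(2 alpha_s) factored out, the linear part costs at most C1 and the power
    term contributes at least eta c1 c0^(p - 1); so c0 phi is a subsolution by [c0_pow]. *)
Lemma c0_phi_le L h dh ddh : 1 < L -> sol L h dh ddh ->
  forall y, - L <= y <= L -> c0 * phi y <= h y.
Proof.
move=> L1 hs; have L0 : 0 < L by lra.
have wd y := twice_derivable_phi alpha_d y.
apply: (subsolution_le coef L0 hs (dw := fun t => c0 * phi^`()%classic t)
    (ddw := fun t => c0 * phi^`(2)%classic t)).
- by move=> y; have [d1 d2] := wd y; split; exact: is_derive_scalefun.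
- by move=> y; exact: mulr_gt0.
- move=> y; have := hC1.2 y; rewrite ler_norml => /andP[h1 _].
  have h2 := hc1.2 y.
  have -> : ell (fun t => c0 * phi t) (fun t => c0 * phi^`()%classic t)
      (fun t => c0 * phi^`(2)%classic t) y = c0 * linear_part m q phi y.
    by rewrite /elliptic /linear_part; ring.
  have -> : (c0 * phi y) `^ p = c0 * phi y * (c0 `^ (p - 1) * phi y `^ (p - 1)).
    rewrite powRM ?(ltW c0_gt0) ?(ltW (phi_gt0 y))// mulrACA.
    by rewrite !mulr_powRB1_gt0.
  have g0 : 0 <= (1 + `|y|) `^ (2 * alpha_s) by exact: powR_ge0.
  set G := (1 + `|y|) `^ (2 * alpha_s) in h1 h2 g0.
  have e1 : eta * c0 `^ (p - 1) * (c1 * G) <= eta * c0 `^ (p - 1) * phi y `^ (p - 1).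
    by rewrite ler_wpM2l// mulr_ge0 ?powR_ge0 ?(ltW (coef_eta_gt0 coef)).
  have e2 : C1 * G <= eta * c1 * c0 `^ (p - 1) * G by rewrite ler_wpM2r.
  have e3 : C1 * G <= eta * (c0 `^ (p - 1) * phi y `^ (p - 1)) by lra.
  have e4 : 0 <= linear_part m q phi y + C1 * phi y * G by lra.
  have e5 : C1 * G * phi y <= eta * (c0 `^ (p - 1) * phi y `^ (p - 1)) * phi y.
    by rewrite ler_wpM2r// ltW.
  have -> : c0 * linear_part m q phi y +
      eta * (c0 * phi y * (c0 `^ (p - 1) * phi y `^ (p - 1))) =
      c0 * (linear_part m q phi y +
        eta * (c0 `^ (p - 1) * phi y `^ (p - 1)) * phi y) by ring.
  by rewrite mulr_ge0 ?(ltW c0_gt0)//; lra.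
- by rewrite (sol_left hs).
- by rewrite (sol_right hs).
Qed.

End c0_barrier.

End barrier.

(** * Regularity of the limit and its two-sided bound *)

Theorem lemma3p4 (R : realType) (n : nat) (alpha : R) (m : market R n)
    (q : preferences R) (kappa_low C_s alpha_s : R) (h : R -> R -> R)
    (halpha : 0 < alpha < 1)
    (hm : market_assumptions m alpha)
    (hq : preference_assumptions q)
    (hkappa_low : 0 < kappa_low)
    (hkappa : kappa_low <= inf (range (kappa_fun m q)))
    (hC_s : 0 < C_s) (halpha_s : 0 < alpha_s)
    (hgrowth : forall y : R,
       `|mkt_a m y| + `|b_tilde m q y| + kappa_fun m q y
         <= C_s * (1 + `|y| `^ alpha_s))
    (hh : forall L : R, 1 < L -> classical_solution m q L (h L)) :
  exists (L_ : nat -> R) (hstar : R -> R),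
    [/\ (forall k, 1 < L_ k) /\ L_ k @[k --> \oo] --> +oo,
        (forall y, 0 < hstar y) /\ Ckholder 2 alpha hstar,
        cvg_loc_C2 (fun k => h (L_ k)) hstar,
        forall y, solves_ode_at m q hstar y &
        forall alpha_d C1 c1 : R,
          Num.max alpha_s (2 * alpha_s / (1 - pexp m q)) < alpha_d ->
          admissible_C1 m q alpha_s alpha_d C1 ->
          admissible_c1 m q alpha_s alpha_d c1 ->
          forall y,
            c0_cst m q C_s alpha_s alpha_d C1 c1 * (1 + y ^+ 2) `^ (- alpha_d / 2)
              <= hstar y
            <= Num.max kappa_low^-1
                 ((eta_cst m q / kappa_low) `^ (1 - pexp m q)^-1)].
Proof.
have hk y : kappa_low <= kappa_fun m q y.
  (* A set without infimum has [inf] equal to 0 by convention, which the positive [kappa_low]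
     excludes. *)
  have [hinf|/inf_out hinf] := pselect (has_inf (range (kappa_fun m q))).
    by apply: (le_trans hkappa); apply: (ge_inf hinf.2); exists y.
  by move: hkappa; rewrite hinf leNgt hkappa_low.
have coef := regular_market_coefficients halpha hm hq hkappa_low hk.
have hs (L : R) (L1 : 1 < L) := classical_dirichlet_solution (hh L L1).
have [L_ [g [dg [ddg [[L1 Loo] [c0 c1 c2] gd g0 geq]]]]] :=
  exists_limit_solution coef hs.
have [e1 e2] := derive2_fun gd.
have Llt y : \forall k \near \oo, - L_ k <= y <= L_ k.
  have /cvgryPge/(_ `|y|)[N _ hN] := Loo.
  by exists N => // k /hN; rewrite -ler_norml.
exists L_, g; split => //.
- split=> //; split.
    move=> [_ y|[_ y|//]]; have [d1 d2] := gd y; first exact: ex_derive.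
    by rewrite derive1n1 e1; exact: ex_derive.
  rewrite e2; apply: loc_lipschitz_holder; first by lra.
  have gl : loc_lipschitz g.
    apply: (@loc_lipschitz_derive _ g dg) => [y|K]; first exact: (gd y).1.
    have [|C C0 hC] := @continuous_bounded_sym _ dg K; last by exists C.
    by move=> y; exact: is_derive_continuous (gd y).2.
  have A0 y : mkt_a m y ^+ 2 != 0 by rewrite gt_eqF// (coef_A_gt0 coef).
  have ddgE y := equation_rhs coef (geq y).
  (* Bootstrap: the equation bounds h'' locally, so h' is locally Lipschitz; then h'' itself,
     written through [rhs], is a combination of locally Lipschitz functions. *)
  have dgl : loc_lipschitz dg.
    apply: (@loc_lipschitz_derive _ dg ddg) => [y|K]; first exact: (gd y).2.
    have gc := loc_lipschitz_continuous gl.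
    have [x _|x _|c c_gt0 gc0] := @continuous_gt0_itv _ g (- K) K.
    - exact: gc.
    - exact: g0.
    have [B B0 gB] := continuous_bounded_sym K gc.
    have dgc y : {for y, continuous dg} by exact: is_derive_continuous (gd y).2.
    have [D D0 dgD] := continuous_bounded_sym K dgc.
    have [C C0 hC] := rhs_bound coef K B c_gt0.
    exists (C * (1 + D)) => y yK; rewrite ddgE.
    apply: (@le_trans _ _ (C * (1 + `|dg y|))).
      by apply: hC => //; rewrite gc0//= (le_trans (ler_norm _))// gB.
    by rewrite ler_pM2l// lerD2l dgD.
  have -> : ddg = fun y => ddg y by [].
  under eq_fun do rewrite ddgE.
  apply: loc_lipschitzM.
    apply: loc_lipschitzM; first exact: loc_lipschitz_cst.
    by apply: loc_lipschitzV => //; exact: a2_loc_lipschitz hm.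
  apply: loc_lipschitzD; last first.
    apply: loc_lipschitzN; apply: loc_lipschitzM => //.
    exact: b_tilde_loc_lipschitz halpha hm.
  apply: loc_lipschitzD.
    by apply: loc_lipschitzM => //; exact: kappa_loc_lipschitz halpha hm.
  apply: loc_lipschitzN; apply: loc_lipschitzM; first exact: loc_lipschitz_cst.
  exact: loc_lipschitz_powR.
- move=> [|[|[|//]]] _ K Kc; rewrite ?e2.
  + exact: cvg_loc_unif_uniform c0 Kc.
  + by rewrite derive1n1 e1; exact: cvg_loc_unif_uniform c1 Kc.
  + exact: cvg_loc_unif_uniform c2 Kc.
- move=> y; have := geq y; rewrite /solves_ode_at /linear_part.
  by rewrite e1 e2.
(* The sequence is already fixed, but both bounds hold for every L > 1, so they pass to the limit
   along it for each admissible choice of constants. *)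
- move=> v C1 c1' vbig hC1 hc1 y.
  have alpha_sv : alpha_s < v by apply: le_lt_trans vbig; rewrite le_max lexx.
  have cy := @cvg_loc_unif_pointwise _ _ _ y c0.
  apply/andP; split.
    apply: (cvgr_to_ge cy); near=> k.
    apply: (c0_phi_le hC_s halpha_s coef hgrowth alpha_sv hC1 hc1 (L1 k) (hs _ (L1 k))).
    by near: k; exact: Llt.
  apply: (cvgr_to_le cy); near=> k.
  apply: (sol_le coef _ (hs _ (L1 k))); first by apply: lt_trans (L1 k).
  by near: k; exact: Llt.
Unshelve. all: by end_near. Qed.
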